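(* Let $d\ge 1$ and let $(S_t)_{t\in\mathbb{N}}$ be any family of subsets of $\mathbb{N}^d$. With Properties 1, 2, 3, 3a, 3b and 4 as defined in the context, the following implications hold for the family $(S_t)$: Property 4 implies Property 2; Property 4 implies Property 3a; Property 4 implies Property 3b; Property 2 implies Property 1; Property 3a implies Property 3; Property 3b implies Property 3; and Property 3 implies Property 1.
   Context: $\mathbb{N}=\{0,1,2,\dots\}$. A function $g:\mathbb{N}\to\mathbb{Q}$ is a quasi-polynomial if there exist a period $m\ge 1$ and polynomials $p_0,\dots,p_{m-1}\in\mathbb{Q}[t]$ with $g(t)=p_i(t)$ whenever $t\equiv i \bmod m$. A function on $\mathbb{N}$ is eventually a quasi-polynomial if there is $T$ such that it agrees with a quasi-polynomial for all $t\ge T$. A set $A\subseteq\mathbb{N}$ is eventually periodic if there exist $T$ and $m\ge1$ such that for all $t\ge T$, $t\in A\iff t+m\in A$. A vector in $\mathbb{Z}^d$ is lexicographically positive if it is nonzero and its first nonzero entry is positive. For $\mathbf{x}=(x_1,\dots,x_d)$ and $\mathbf{s}\in\mathbb{Z}^d$, $\mathbf{x}^{\mathbf{s}}=x_1^{s_1}\cdots x_d^{s_d}$. For a family $(S_t)_{t\in\mathbb{N}}$ of subsets of $\mathbb{N}^d$: Property 1: The set of $t$ such that $S_t$ is nonempty is eventually periodic. Property 2: There exists a function $g:\mathbb{N}\to\mathbb{N}$ such that $g(t)=|S_t|$ whenever $S_t$ has finite cardinality, and $g$ is eventually a quasi-polynomial. Moreover, the set of $t$ such that $S_t$ has finite cardinality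 is eventually periodic. Property 3: There exists a function $\mathbf{x}:\mathbb{N}\to\mathbb{N}^d$ such that, if $S_t$ is nonempty, then $\mathbf{x}(t)\in S_t$, and the coordinate functions of $\mathbf{x}$ are eventually quasi-polynomials. Moreover, the set of $t$ such that $S_t$ is nonempty is eventually periodic. Property 3a: For every $\mathbf{c}\in\mathbb{Z}^d\setminus\{0\}$, there exists a function $\mathbf{x}:\mathbb{N}\to\mathbb{N}^d$ such that, if $\max_{\mathbf{y}\in S_t}\mathbf{c}\cdot\mathbf{y}$ exists, then it is attained at $\mathbf{x}(t)\in S_t$, and the coordinate functions of $\mathbf{x}$ are eventually quasi-polynomials. Moreover, the set of $t$ such that the maximum exists is eventually periodic. Property 3b: For every $k\in\mathbb{N}$, there exist functions $\mathbf{x}_1,\dots,\mathbf{x}_k:\mathbb{N}\to\mathbb{N}^d$ such that, if $|S_t|\ge k$, then $\mathbf{x}_1(t),\dots,\mathbf{x}_k(t)$ are distinct elements of $S_t$, and the coordinate functions of the $\mathbf{x}_i$ are eventually quasi-polynomials. Moreover, the set of $t$ such that $|S_t|\ge k$ is eventually periodic. Property 4: There exists a period $m\ge 1$ such that, for each residue $i$ modulo $m$ and all sufficiently large $t\equiv i\bmod m$, $$\sum_{\mathbf{s}\in S_t}\mathbf{x}^{\mathbf{s}}=\frac{\sum_{j=1}^{n_i}\alpha_{ij}\mathbf{x}^{\mathbf{q}_{ij}(t)}}{(1-\mathbf{x}^{\mathbf{b}_{i1}(t)})\cdots(1-\mathbf{x}^{\mathbf{b}_{ik_i}(t)})},$$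 where $n_i,k_i\in\mathbb{N}$ and $\alpha_{ij}\in\mathbb{Q}$ do not depend on $t$, the coordinates of $\mathbf{q}_{ij}$ and $\mathbf{b}_{ij}$ are polynomials in $\mathbb{Q}[t]$ with $\mathbf{q}_{ij}(t),\mathbf{b}_{ij}(t)\in\mathbb{Z}^d$ for such $t$, and the $\mathbf{b}_{ij}(t)$ are lexicographically positive. Here a rational function is identified with the Laurent series obtained by expanding each factor $1/(1-\mathbf{x}^{\mathbf{b}})$ as $1+\mathbf{x}^{\mathbf{b}}+\mathbf{x}^{2\mathbf{b}}+\cdots$, which converges near $(e^{-\varepsilon},e^{-\varepsilon^2},\dots,e^{-\varepsilon^d})$ for sufficiently small $\varepsilon>0$. *)

(* Defs.v *)
From mathcomp Require Import all_boot all_order all_algebra finmap.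
From mathcomp Require Import boolp classical_sets functions cardinality fsbigop.

Set Implicit Arguments.
Unset Strict Implicit.
Unset Printing Implicit Defensive.

Import Order.TTheory GRing.Theory Num.Theory.

Local Open Scope classical_set_scope.
Local Open Scope card_scope.
Local Open Scope ring_scope.

Definition quasi_polynomial (g : nat -> rat) : Prop :=
  exists m : nat, (0 < m)%N /\
  exists p : 'I_m -> {poly rat},
  forall (t : nat) (i : 'I_m), t = i %[mod m] -> g t = (p i).[t%:R].

Definition eventually_qp (f : nat -> rat) : Prop :=
  exists (T : nat) (g : nat -> rat),
    quasi_polynomial g /\ forall t : nat, (T <= t)%N -> f t = g t.

Definition eventually_qp_vec (d : nat) (x : nat -> 'rV[nat]_d) : Prop :=
  forall l : 'I_d, eventually_qp (fun t => (x t 0 l)%:R).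

Definition eventually_periodic (A : set nat) : Prop :=
  exists T m : nat, (0 < m)%N /\
  forall t : nat, (T <= t)%N -> (A t <-> A (t + m)%N).

Definition lex_positive (d : nat) (v : 'rV[int]_d) : Prop :=
  v != 0 /\
  forall l : 'I_d, v 0 l != 0 -> (forall l' : 'I_d, (l' < l)%N -> v 0 l' = 0) ->
    0 < v 0 l.

Definition dot (d : nat) (c : 'rV[int]_d) (y : 'rV[nat]_d) : int :=
  \sum_(l < d) c 0 l * (y 0 l)%:Z.

Definition maximizes (d : nat) (c : 'rV[int]_d) (A : set 'rV[nat]_d)
    (y : 'rV[nat]_d) : Prop :=
  A y /\ forall z : 'rV[nat]_d, A z -> dot c z <= dot c y.

(* A formal Laurent series in x_1, ..., x_d is the function sending an exponent
   vector to its coefficient.  The sums \sum_(i \in A) below are finite-support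
   sums, equal to 0 by convention on an infinite support.  This convention is
   never used in rational_series when the vectors b j are lexicographically
   positive: some linear form is positive on all of them, so that every
   coefficient involves finitely many nonzero terms. *)
Definition laurent (d : nat) : Type := 'rV[int]_d -> rat.

Definition monomial (d : nat) (q : 'rV[int]_d) : laurent d :=
  fun u => (u == q)%:R.

Definition laurent_mul (d : nat) (f g : laurent d) : laurent d :=
  fun u => \sum_(v \in [set: 'rV[int]_d]) f v * g (u - v).

(* 1 / (1 - x^b) expanded as 1 + x^b + x^(2b) + ... *)
Definition geometric (d : nat) (b : 'rV[int]_d) : laurent d :=
  fun u => \sum_(n \in [set: nat]) monomial (b *+ n) u.

Definition rational_series (d n k : nat) (alpha : 'I_n -> rat)
    (q : 'I_n -> 'rV[int]_d) (b : 'I_k -> 'rV[int]_d) : laurent d :=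
  laurent_mul (fun u => \sum_(j < n) alpha j * monomial (q j) u)
    (\big[@laurent_mul d / monomial 0]_(j < k) geometric (b j)).

Definition generating_series (d : nat) (A : set 'rV[nat]_d) : laurent d :=
  fun u => \sum_(s \in A) monomial (map_mx Posz s) u.

Definition evaluates_to (d : nat) (p : 'rV[{poly rat}]_d) (t : nat)
    (v : 'rV[int]_d) : Prop :=
  forall l : 'I_d, (p 0 l).[t%:R] = (v 0 l)%:~R.

Definition property1 (d : nat) (S : nat -> set 'rV[nat]_d) : Prop :=
  eventually_periodic [set t | S t !=set0].

Definition property2 (d : nat) (S : nat -> set 'rV[nat]_d) : Prop :=
  (exists g : nat -> nat,
     (forall t : nat, finite_set (S t) -> g t = #|` fset_set (S t)|%fset) /\
     eventually_qp (fun t => (g t)%:R)) /\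
  eventually_periodic [set t | finite_set (S t)].

Definition property3 (d : nat) (S : nat -> set 'rV[nat]_d) : Prop :=
  (exists x : nat -> 'rV[nat]_d,
     (forall t : nat, S t !=set0 -> S t (x t)) /\ eventually_qp_vec x) /\
  eventually_periodic [set t | S t !=set0].

Definition property3a (d : nat) (S : nat -> set 'rV[nat]_d) : Prop :=
  forall c : 'rV[int]_d, c != 0 ->
  (exists x : nat -> 'rV[nat]_d,
     (forall t : nat, (exists y, maximizes c (S t) y) ->
        maximizes c (S t) (x t)) /\
     eventually_qp_vec x) /\
  eventually_periodic [set t | exists y, maximizes c (S t) y].

Definition property3b (d : nat) (S : nat -> set 'rV[nat]_d) : Prop :=
  forall k : nat,
  (exists x : 'I_k -> nat -> 'rV[nat]_d,
     (forall t : nat, `I_k #<= S t ->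
        injective (fun i => x i t) /\ forall i : 'I_k, S t (x i t)) /\
     forall i : 'I_k, eventually_qp_vec (x i)) /\
  eventually_periodic [set t | `I_k #<= S t].

Definition property4 (d : nat) (S : nat -> set 'rV[nat]_d) : Prop :=
  exists m : nat, (0 < m)%N /\
  forall i : 'I_m,
  exists (n k : nat) (alpha : 'I_n -> rat)
         (q : 'I_n -> 'rV[{poly rat}]_d) (b : 'I_k -> 'rV[{poly rat}]_d)
         (T : nat),
  forall t : nat, (T <= t)%N -> t = i %[mod m] ->
  exists (qt : 'I_n -> 'rV[int]_d) (bt : 'I_k -> 'rV[int]_d),
    [/\ forall j : 'I_n, evaluates_to (q j) t (qt j),
        forall j : 'I_k, evaluates_to (b j) t (bt j),
        forall j : 'I_k, lex_positive (bt j) &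
        generating_series (S t) = rational_series alpha qt bt].

(* Main.v *)
(* Multiplying the generating series f of S_t by prod_l (1 - x^(b_l(t))) is applying
   the difference operators f |-> f - f(. - b_l(t)), and gives a Laurent polynomial
   N_t whose exponents q_j(t) and coefficients are explicit.  On a residue class,
   every condition expressed by signs and zeros of polynomials in t is eventually
   true or eventually false, so it suffices to express everything that way.

   For a total group order on Z^d, multiplication by 1 - x^b moves the leading
   exponent by max(0, b).  Hence the largest point of S_t, when it exists, is
   q_j(t) - sum_l max(0, b_l(t)) for an eventually constant j.  Comparing first by c
   and then by coordinates yields maximizers of c (3a); removing the
   lexicographic minimum again and again yields k distinct points (3b).

   It remains to decide whether c is bounded on S_t.  It is iff, for every b with
   c b > 0 occurring k times up to proportionality among the b_l, the sum of
   N_t(u) p(c u) over each line parallel to b vanishes for all p of degree < k.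
   Necessity is summation by parts.  For sufficiency one divides N_t by such factors
   one at a time: with b = g w, w primitive, 1 - x^b = (1 + x^w + ... + x^((g-1)w))(1 - x^w),
   and multiplying f >= 0 by the first factor can only enlarge its support.

   S_t is finite iff its coordinates are bounded.  In that case, for a linear form
   with nonzero values on all b_l, summation by parts against its k-th power gives
   |S_t| as a quotient of polynomials in t; as it is an integer, it is a polynomial. *)
Require Import Defs.
From mathcomp Require Import all_boot all_order all_algebra.
From mathcomp Require Import classical_sets.
From mathcomp Require Import finmap boolp cardinality fsbigop zify ring lra.

Set Implicit Arguments.
Unset Strict Implicit.
Unset Printing Implicit Defensive.

Import Order.TTheory GRing.Theory Num.Theory.

Local Open Scope classical_set_scope.
Local Open Scope ring_scope.

(** * Germs of polynomials at infinity along a residue class *)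

(** Induction on the Horner form q X + c: once q is at least e, any t beyond (1 - c) / e gives q(t)
    t + c at least 1. Mere positivity of q would not carry the induction, hence the uniform
    bound. *)
Lemma poly_ge_eventually (p : {poly rat}) : 0 < lead_coef p ->
  exists e : rat, 0 < e /\
  exists T : nat, forall t : nat, (T <= t)%N -> e <= p.[t%:R].
Proof.
elim/poly_ind: p => [|q c IH]; first by rewrite lead_coef0 ltxx.
have [->|q0] := eqVneq q 0.
  rewrite mul0r add0r lead_coefC => c0; exists c; split=> //.
  by exists 0%N => t _; rewrite hornerC.
have -> : lead_coef (q * 'X + c%:P) = lead_coef q.
  rewrite lead_coefDl ?lead_coefMX // size_mulX // size_polyC.
  by rewrite ltnS (leq_trans (leq_b1 _)) // size_poly_gt0.
move=> /IH[e [e0 [T hT]]]; exists 1; split=> //.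
set n := Num.bound `|(1 - c) / e|.
exists (maxn T n) => t; rewrite geq_max => /andP[/hT hq hn].
have h1 : `|(1 - c) / e| < n%:R by apply: archi_boundP.
have h2 : (1 - c) / e <= t%:R.
  by rewrite (le_trans (ler_norm _)) // (le_trans (ltW h1)) // ler_nat.
rewrite ler_pdivrMr // in h2.
rewrite hornerD hornerMX hornerC.
have h3 : e * t%:R <= q.[t%:R] * t%:R by rewrite ler_wpM2r.
by nra.
Qed.

Lemma poly_common_denom (p : {poly rat}) :
  exists D : nat, (0 < D)%N /\
  forall t : nat, exists z : int, D%:R * p.[t%:R] = z%:~R.
Proof.
elim/poly_ind: p => [|q c [D [D0 hD]]].
  by exists 1%N; split=> // t; exists 0; rewrite horner0 mulr0.
have hc := divq_num_den c.
have c0 := denq_gt0 c.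
have hd : (`|denq c|%N)%:R = (denq c)%:~R :> rat.
  by rewrite -[in RHS](gtz0_abs c0).
exists (D * `|denq c|)%N; split; first by rewrite muln_gt0 D0 absz_gt0 denq_neq0.
move=> t; have [z hz] := hD t.
exists (z * t%:Z * denq c + D%:Z * numq c).
rewrite hornerD hornerMX hornerC natrM hd mulrDr mulrACA mulrA rmorphD /= !rmorphM /= -hz -!pmulrn.
have c1 : (denq c)%:~R != 0 :> rat by rewrite intr_eq0 denq_neq0.
have -> : (numq c)%:~R = c * (denq c)%:~R by apply: (canRL (mulfVK c1)).
by ring.
Qed.

Section Germs.

Variables (m i : nat).

Definition near_class (P : nat -> Prop) : Prop :=
  exists T : nat, forall t : nat, (T <= t)%N -> t = i %[mod m] -> P t.

Definition germ_poly (F : nat -> rat) : Prop :=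
  exists p : {poly rat}, near_class (fun t => F t = p.[t%:R]).

(** The eventual dichotomy. It is stable under Boolean operations and finite quantifiers and holds
    for sign conditions on polynomial germs; having it on every class modulo m yields eventual
    periodicity. *)
Definition germ_dec (P : nat -> Prop) : Prop :=
  near_class P \/ near_class (fun t => ~ P t).

Lemma near_mono (P Q : nat -> Prop) :
  (forall t, P t -> Q t) -> near_class P -> near_class Q.
Proof. by move=> h [T hT]; exists T => t /hT H /H /h. Qed.

Lemma near_all (P : nat -> Prop) : (forall t, P t) -> near_class P.
Proof. by exists 0%N. Qed.

Lemma near_ge (n : nat) : near_class (fun t => (n <= t)%N).
Proof. by exists n. Qed.

Lemma near_and (P Q : nat -> Prop) :
  near_class P -> near_class Q -> near_class (fun t => P t /\ Q t).
Proof.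
move=> [T hT] [T' hT']; exists (maxn T T') => t.
by rewrite geq_max => /andP[/hT h /hT' h'] ht; split; [exact: h|exact: h'].
Qed.

Lemma near_mono2 (P Q R : nat -> Prop) :
  (forall t, P t -> Q t -> R t) -> near_class P -> near_class Q -> near_class R.
Proof.
by move=> h hP hQ; apply: near_mono (near_and hP hQ) => t [hp hq]; exact: h.
Qed.

Lemma near_forall (I : finType) (P : I -> nat -> Prop) :
  (forall j, near_class (P j)) -> near_class (fun t => forall j, P j t).
Proof.
move=> /choice[T hT]; exists (\max_j T j) => t ht hi j.
by apply: (hT j) => //; apply: leq_trans ht; apply: leq_bigmax.
Qed.

Lemma near_witness (P : nat -> Prop) : (0 < m)%N ->
  near_class P -> forall n : nat, exists t, [/\ (n <= t)%N, t = i %[mod m] & P t].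
Proof.
move=> m0 [T hT] n; have h : (i + m * maxn T n)%N = i %[mod m] by rewrite addnC mulnC modnMDl.
have hle : (maxn T n <= i + m * maxn T n)%N by nia.
exists (i + m * maxn T n)%N; split=> //.
  by apply: leq_trans hle; exact: leq_maxr.
by apply: hT => //; apply: leq_trans hle; exact: leq_maxl.
Qed.

(** * Eventually decided predicates *)

Lemma dec_near (P Q : nat -> Prop) :
  near_class (fun t => P t <-> Q t) -> germ_dec P -> germ_dec Q.
Proof.
move=> h [hP|hP]; [left|right]; apply: near_mono2 h hP => t [h1 h2] //.
by move=> nP /h2.
Qed.

Lemma dec_ext (P Q : nat -> Prop) :
  (forall t, P t <-> Q t) -> germ_dec P -> germ_dec Q.
Proof. by move=> h; apply: dec_near; apply: near_all. Qed.

Lemma dec_not (P : nat -> Prop) : germ_dec P -> germ_dec (fun t => ~ P t).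
Proof.
by case=> h; [right; apply: near_mono h => t ? //|left].
Qed.

Lemma dec_and (P Q : nat -> Prop) :
  germ_dec P -> germ_dec Q -> germ_dec (fun t => P t /\ Q t).
Proof.
move=> [hP|hP]; last by right; apply: near_mono hP => t hp [].
move=> [hQ|hQ]; last by right; apply: near_mono hQ => t hq [].
by left; apply: near_and.
Qed.

Lemma dec_or (P Q : nat -> Prop) :
  germ_dec P -> germ_dec Q -> germ_dec (fun t => P t \/ Q t).
Proof.
move=> hP hQ; apply: dec_ext (dec_not (dec_and (dec_not hP) (dec_not hQ))) => t.
split; first by move=> /not_andP[] /contrapT; [left|right].
by case=> h [].
Qed.

Lemma dec_imp (P Q : nat -> Prop) :
  germ_dec P -> germ_dec Q -> germ_dec (fun t => P t -> Q t).
Proof.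
move=> hP hQ; apply: dec_ext (dec_or (dec_not hP) hQ) => t.
split; first by case.
by move=> h; case: (pselect (P t)) => [/h|]; [right|left].
Qed.

Lemma dec_forall (I : finType) (P : I -> nat -> Prop) :
  (forall j, germ_dec (P j)) -> germ_dec (fun t => forall j, P j t).
Proof.
move=> h; case: (pselect (forall j, near_class (P j))) => [hP|].
  by left; apply: near_forall.
move=> /existsNP[j hj]; right.
by case: (h j) => // hn; apply: near_mono hn => t hn /(_ j).
Qed.

(** * Closure properties of polynomial germs *)

Lemma poly_near (F G : nat -> rat) :
  near_class (fun t => F t = G t) -> germ_poly F -> germ_poly G.
Proof. by move=> h [p hp]; exists p; apply: near_mono2 h hp => t ->. Qed.

Lemma poly_ext (F G : nat -> rat) : F =1 G -> germ_poly F -> germ_poly G.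
Proof. by move=> h; apply: poly_near; apply: near_all. Qed.

Lemma poly_cst (c : rat) : germ_poly (fun=> c).
Proof. by exists c%:P; apply: near_all => t; rewrite hornerC. Qed.

Lemma poly_add (F G : nat -> rat) :
  germ_poly F -> germ_poly G -> germ_poly (fun t => F t + G t).
Proof.
move=> [p hp] [q hq]; exists (p + q).
by apply: near_mono2 hp hq => t -> ->; rewrite hornerD.
Qed.

Lemma poly_mul (F G : nat -> rat) :
  germ_poly F -> germ_poly G -> germ_poly (fun t => F t * G t).
Proof.
move=> [p hp] [q hq]; exists (p * q).
by apply: near_mono2 hp hq => t -> ->; rewrite hornerM.
Qed.

Lemma poly_opp (F : nat -> rat) : germ_poly F -> germ_poly (fun t => - F t).
Proof.
by move=> h; apply: poly_ext (poly_mul (poly_cst (-1)) h) => t; rewrite mulN1r.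
Qed.

Lemma poly_sub (F G : nat -> rat) :
  germ_poly F -> germ_poly G -> germ_poly (fun t => F t - G t).
Proof. by move=> hF hG; apply: poly_add hF (poly_opp hG). Qed.

Lemma poly_exp (F : nat -> rat) (n : nat) :
  germ_poly F -> germ_poly (fun t => F t ^+ n).
Proof.
move=> h; elim: n => [|n IH]; first by apply: poly_ext (poly_cst 1).
by apply: poly_ext (poly_mul h IH) => t; rewrite exprS.
Qed.

Lemma poly_sum (I : Type) (s : seq I) (F : I -> nat -> rat) :
  (forall j, germ_poly (F j)) -> germ_poly (fun t => \sum_(j <- s) F j t).
Proof.
move=> h; elim: s => [|j s IH].
  by apply: poly_ext (poly_cst 0) => t; rewrite big_nil.
by apply: poly_ext (poly_add (h j) IH) => t; rewrite big_cons.
Qed.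

Lemma poly_prod (I : Type) (s : seq I) (F : I -> nat -> rat) :
  (forall j, germ_poly (F j)) -> germ_poly (fun t => \prod_(j <- s) F j t).
Proof.
move=> h; elim: s => [|j s IH].
  by apply: poly_ext (poly_cst 1) => t; rewrite big_nil.
by apply: poly_ext (poly_mul (h j) IH) => t; rewrite big_cons.
Qed.

Lemma poly_if (b : nat -> bool) (F G : nat -> rat) :
  germ_dec b -> germ_poly F -> germ_poly G ->
  germ_poly (fun t => if b t then F t else G t).
Proof.
move=> [h|h] hF hG; [apply: poly_near hF|apply: poly_near hG];
  apply: near_mono h => t; first by move=> ->.
by move=> /negP/negbTE ->.
Qed.

(** The sign of the leading coefficient decides; every other sign condition reduces to this one. *)
Lemma dec_gt0 (F : nat -> rat) : germ_poly F -> germ_dec (fun t => 0 < F t).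
Proof.
move=> [p hp]; have [l0|l0] := ltP 0 (lead_coef p).
  left; have [e [e0 [T hT]]] := poly_ge_eventually l0.
  apply: near_mono2 hp (near_ge T) => t -> /hT; exact: lt_le_trans.
right; have [p0|p0] := eqVneq p 0.
  by apply: near_mono hp => t ->; rewrite p0 horner0 ltxx.
have l1 : 0 < lead_coef (- p).
  by rewrite lead_coefN oppr_gt0 lt_neqAle l0 lead_coef_eq0 p0.
have [e [e0 [T hT]]] := poly_ge_eventually l1.
apply: near_mono2 hp (near_ge T) => t -> /hT.
by rewrite hornerN => h h'; lra.
Qed.

Lemma dec_eq0 (F : nat -> rat) : germ_poly F -> germ_dec (fun t => F t = 0).
Proof.
move=> h; apply: dec_ext (dec_and (dec_not (dec_gt0 h)) (dec_not (dec_gt0 (poly_opp h)))) => t.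
split=> [[/negP h1 /negP h2]|->]; first by apply/eqP; lra.
by rewrite oppr0 ltxx.
Qed.

Lemma dec_le (F G : nat -> rat) :
  germ_poly F -> germ_poly G -> germ_dec (fun t => F t <= G t).
Proof.
move=> hF hG; apply: dec_ext (dec_not (dec_gt0 (poly_sub hF hG))) => t.
by rewrite subr_gt0 leNgt; split => /negP.
Qed.

Lemma dec_lt (F G : nat -> rat) :
  germ_poly F -> germ_poly G -> germ_dec (fun t => F t < G t).
Proof.
by move=> hF hG; apply: dec_ext (dec_gt0 (poly_sub hG hF)) => t; rewrite subr_gt0.
Qed.

Lemma dec_eq (F G : nat -> rat) :
  germ_poly F -> germ_poly G -> germ_dec (fun t => F t = G t).
Proof.
move=> hF hG; apply: dec_ext (dec_eq0 (poly_sub hF hG)) => t.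
by split=> [/eqP|->]; [rewrite subr_eq0 => /eqP|rewrite subrr].
Qed.

Lemma poly_nonzero_near (p : {poly rat}) : p != 0 ->
  near_class (fun t => p.[t%:R] != 0).
Proof.
move=> p0; have h : germ_poly (fun t => p.[t%:R] ^+ 2).
  by apply: poly_exp; exists p; apply: near_all.
have l1 : 0 < lead_coef (p ^+ 2).
  by rewrite lead_coef_exp exprn_even_gt0 //= lead_coef_eq0.
have [e [e0 [T hT]]] := poly_ge_eventually l1.
exists T => t /hT hle _; apply/eqP => p1.
by move: hle; rewrite horner_exp p1 expr0n /= => /(lt_le_trans e0); rewrite ltxx.
Qed.

(* Writing A = B Q + R, a nonzero R would make D R / B a nonzero integer
   tending to 0, where D is a common denominator of the coefficients of Q. *)
Lemma poly_integral_quotient (F : nat -> int) (A B : nat -> rat) :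
  germ_poly A -> germ_poly B -> near_class (fun t => B t != 0) ->
  near_class (fun t => (F t)%:~R * B t = A t) ->
  germ_poly (fun t => (F t)%:~R).
Proof.
move=> [p hp] [q hq] hB hF.
(* Contradictory cases show that the hypotheses fail eventually along the class, where the zero
   polynomial then fits vacuously. *)
have triv : near_class (fun=> False) -> germ_poly (fun t => (F t)%:~R).
  by move=> h; exists 0; apply: near_mono h.
have [q0|q0] := eqVneq q 0.
  by apply: triv; apply: near_mono2 hq hB => t ->; rewrite q0 horner0 eqxx.
set Q := p %/ q; set R := p %% q.
have [D [D0 hD]] := poly_common_denom Q.
have [R0|R0] := eqVneq R 0.
  exists Q; apply: near_mono2 (near_and hp hq) (near_and hB hF).
  move=> t [hpt hqt] [hb hf]; apply: (mulIf hb).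
  rewrite hf hpt hqt -hornerM; congr _.[_].
  by rewrite [LHS](divp_eq p q) -/R R0 addr0.
apply: triv.
(* As R has smaller degree than q, comparing squares gives |D R(t)| < |q(t)| for large t, whereas
   the quotient D R(t) / q(t) will be the nonzero integer [w]. *)
have lpos : 0 < lead_coef (q ^+ 2 - (D%:R *: R) ^+ 2).
  rewrite lead_coefDl ?lead_coef_exp ?exprn_even_gt0 ?lead_coef_eq0 //.
  have DR0 : D%:R *: R != 0 by rewrite scaler_eq0 negb_or R0 pnatr_eq0 -lt0n D0.
  rewrite size_polyN !expr2 !size_mul // size_scale ?pnatr_eq0 -?lt0n //.
  have h1 : (size R < size q)%N by rewrite ltn_modp.
  have h2 : (0 < size R)%N by rewrite size_poly_gt0.
  have gen (x y : nat) : (0 < x)%N -> (x < y)%N -> ((x + x).-1 < (y + y).-1)%N by lia.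
  exact: gen h2 h1.
have [e [e0 [T hT]]] := poly_ge_eventually lpos.
have h1 := near_and (poly_nonzero_near R0) (near_ge T).
apply: near_mono2 h1 (near_and (near_and hp hq) (near_and hB hF)).
move=> t [hR /hT hle] [[hpt hqt] [hb hf]].
have [z hz] := hD t.
have hdiv : p.[t%:R] = Q.[t%:R] * q.[t%:R] + R.[t%:R].
  by rewrite [in LHS](divp_eq p q) hornerD hornerM.
set w := D%:Z * F t - z.
have hw : w%:~R * q.[t%:R] = D%:R * R.[t%:R].
  rewrite rmorphB rmorphM /= -hz mulrBl -mulrA -hqt hf hpt hdiv -hqt -pmulrn.
  by ring.
have w0 : w != 0.
  apply: contraNneq hR => w0; move/eqP: hw.
  rewrite w0 mul0r eq_sym mulf_eq0 pnatr_eq0 => /orP[/eqP D1|//].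
  by rewrite D1 in D0.
have w1 : 1 <= (w%:~R : rat) ^+ 2.
  rewrite -rmorphXn /= -[1]/(1%:~R) ler_int.
  by have : 0 < w ^+ 2 by rewrite exprn_even_gt0.
move: hle; rewrite hornerD hornerN !horner_exp hornerZ -hw exprMn.
have := ler_peMl (sqr_ge0 q.[t%:R]) w1.
by move=> h2 h3; lra.
Qed.

End Germs.

(** * Gluing residue classes *)

Lemma near_refine (m M i : nat) (P : nat -> Prop) : (m %| M)%N ->
  near_class m i P -> near_class M i P.
Proof.
move=> mM [T hT]; exists T => t ht hi; apply: hT => //.
by rewrite -(modn_dvdm t mM) hi modn_dvdm.
Qed.

Lemma dec_refine (m M i : nat) (P : nat -> Prop) : (m %| M)%N ->
  germ_dec m i P -> germ_dec M i P.
Proof. by move=> mM [] h; [left|right]; apply: near_refine mM h. Qed.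

Lemma periodic_of_dec (m : nat) (P : nat -> Prop) : (0 < m)%N ->
  (forall i : 'I_m, germ_dec m i P) -> eventually_periodic P.
Proof.
move=> m0 hP; have /choice[T hT] (i : 'I_m) : exists T, forall t,
    (T <= t)%N -> t = i %[mod m] -> (P t <-> P (t + m)%N).
  have [[T hT]|[T hT]] := hP i; exists T => t ht hi;
    have ht' : (T <= t + m)%N by rewrite (leq_trans ht) ?leq_addr.
  - by split=> _; apply: hT; rewrite ?modnDr.
  - by split=> h; [case: (hT t)|case: (hT (t + m)%N); rewrite ?modnDr].
exists (\max_i T i), m; split=> // t ht.
pose i := Ordinal (ltn_pmod t m0).
apply: (hT i); last by rewrite modn_mod.
by apply: leq_trans ht; apply: leq_bigmax.
Qed.

Lemma dec_of_periodic (P : nat -> Prop) : eventually_periodic P ->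
  exists m : nat, (0 < m)%N /\ forall i, germ_dec m i P.
Proof.
move=> [T [m [m0 h]]]; exists m; split=> // i.
have step k t : (T <= t)%N -> (P t <-> P (t + k * m)%N).
  move=> ht; elim: k => [|k IH]; first by rewrite mul0n addn0.
  rewrite IH h ?(leq_trans ht) ?leq_addr //.
  by rewrite mulSn addnA addnAC.
have key t t' : (T <= t)%N -> (t <= t')%N -> t = t' %[mod m] -> P t <-> P t'.
  move=> ht htt' /eqP; rewrite eq_sym eqn_mod_dvd // => /dvdnP[k hk].
  by rewrite (step k) // -hk subnKC.
(* One true instance beyond T propagates to all later members of its class; without one, P is false
   there beyond T. *)
case: (pselect (exists2 t, (T <= t)%N & t = i %[mod m] /\ P t)) => [[t ht [hi hp]]|no].
  left; exists t => t' ht' hi'; apply/(key t t') => //.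
  by rewrite hi hi'.
by right; exists T => t ht hi hp; apply: no; exists t.
Qed.

(** Both predicates are decided on the classes modulo the product of their periods, so R can be
    treated class by class. *)
Lemma periodic_imp (P Q R : nat -> Prop) :
  (forall m i, germ_dec m i P -> germ_dec m i Q -> germ_dec m i R) ->
  eventually_periodic P -> eventually_periodic Q -> eventually_periodic R.
Proof.
move=> h /dec_of_periodic[m [m0 hP]] /dec_of_periodic[n [n0 hQ]].
apply: (@periodic_of_dec (m * n)) => [|i]; first by rewrite muln_gt0 m0.
apply: h; [apply: dec_refine (hP i)|apply: dec_refine (hQ i)].
  exact: dvdn_mulr.
exact: dvdn_mull.
Qed.

Lemma poly_of_qp (F : nat -> rat) : eventually_qp F ->
  exists m : nat, (0 < m)%N /\ forall i : 'I_m, germ_poly m i F.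
Proof.
move=> [T [g [[m [m0 [p hp]]] hT]]]; exists m; split=> // i.
by exists (p i), T => t /hT -> hi; apply: hp.
Qed.

Lemma qp_of_poly (m : nat) (F : nat -> rat) : (0 < m)%N ->
  (forall i : 'I_m, germ_poly m i F) -> eventually_qp F.
Proof.
move=> m0 /choice[p /choice[T hT]].
pose r t := Ordinal (ltn_pmod t m0).
exists (\max_i T i), (fun t => (p (r t)).[t%:R]); split.
  exists m; split=> //; exists p => t i hi; congr (p _).[_].
  by apply/val_inj; rewrite /= hi modn_small.
move=> t ht; apply: hT; last by rewrite modn_mod.
by apply: leq_trans ht; apply: leq_bigmax.
Qed.

(** Here [G t] is the requirement on the value at t and [co] lists its coordinates. Beyond the
    threshold of its class the polynomial choice is used; below it, any admissible value, which does
    not affect eventual behaviour. *)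
Lemma glue_classes (m : nat) (X A : Type) (co : A -> X -> rat)
    (G : nat -> X -> Prop) : (0 < m)%N ->
  (forall t, exists x, G t x) ->
  (forall i : 'I_m, exists x : nat -> X,
     (forall a, germ_poly m i (fun t => co a (x t))) /\
     near_class m i (fun t => G t (x t))) ->
  exists x : nat -> X,
    (forall t, G t (x t)) /\ forall a, eventually_qp (fun t => co a (x t)).
Proof.
move=> m0 /choice[y hy] /choice[x hx].
have /choice[T hT] (i : 'I_m) : exists T, forall t, (T <= t)%N -> t = i %[mod m] -> G t (x i t).
  by case: (hx i) => _ [T hT]; exists T.
pose r t := Ordinal (ltn_pmod t m0).
have rE (i : 'I_m) t : t = i %[mod m] -> r t = i.
  by move=> h; apply/val_inj; rewrite /= h modn_small.
exists (fun t => if (T (r t) <= t)%N then x (r t) t else y t); split.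
  by move=> t; case: ifP => // h; apply: hT => //; rewrite modn_mod.
move=> a; apply: (qp_of_poly m0) => i.
have [h _] := hx i; apply: poly_near (h a).
by exists (T i) => t ht hi; rewrite (rE i t hi) ht.
Qed.

(** * The implications that do not start from Property 4 *)

Lemma property3_property1 (d : nat) (S : nat -> set 'rV[nat]_d) :
  property3 S -> property1 S.
Proof. by case. Qed.

(** S_t is empty exactly when it is finite and g(t) = 0, and the zero set of an eventual
    quasi-polynomial is eventually periodic. *)
Lemma property2_property1 (d : nat) (S : nat -> set 'rV[nat]_d) :
  property2 S -> property1 S.
Proof.
move=> [[g [hg /poly_of_qp[m [m0 hp]]]] hfin].
have hz : eventually_periodic (fun t => (g t)%:R = 0 :> rat).
  by apply: (periodic_of_dec m0) => i; apply: dec_eq0.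
apply: periodic_imp hz hfin => M i dz df.
apply: dec_ext (dec_not (dec_and dz df)) => t /=.
split=> [h|[s hs] [/eqP h hf]].
  apply: contrapT => /set0P/negP; rewrite negbK => /eqP S0; apply: h.
  by rewrite (hg t) S0 // fset_set0 cardfs0.
move: h; rewrite pnatr_eq0 (hg t hf) cardfs_eq0 => /eqP h.
have : s \in fset_set (S t) by rewrite in_fset_set // mem_set.
by rewrite h.
Qed.

Lemma card_ge_IIP (X : Type) (k : nat) (A : set X) :
  (`I_k #<= A)%card <-> exists x : 'I_k -> X, injective x /\ forall i, A (x i).
Proof.
split=> [/card_leP/injfunPex[f _ f_inj]|[x [x_inj hx]]].
  have hi (i : 'I_k) : (i : nat) \in `I_k by rewrite mem_set //=; exact: ltn_ord.
  exists (fun i : 'I_k => val (f (exist _ (i : nat) (hi i)))); split=> [i j /val_inj h|i].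
    have e := f_inj _ _ (in_setT _) (in_setT _) h.
    by apply/val_inj; move: (congr1 (@proj1_sig _ _) e).
  by apply: set_mem; apply: valP.
apply/card_leP/injfunPex.
have hn (n : `I_k) : (val n < k)%N by have := set_mem (valP n).
have hA i : x i \in A by rewrite mem_set.
exists (fun n => exist _ (x (Ordinal (hn n))) (hA _)) => // n n' _ _ /(congr1 val) /x_inj.
by move=> /(congr1 val) h; apply: val_inj.
Qed.

Lemma property3b_property3 (d : nat) (S : nat -> set 'rV[nat]_d) :
  property3b S -> property3 S.
Proof.
move=> /(_ 1%N)[[x [hx qx]] hp].
have key t : (`I_1 #<= S t)%card <-> S t !=set0.
  split=> [/card_ge_IIP[f [_ hf]]|[s hs]]; first by exists (f ord0).
  apply/card_ge_IIP; exists (fun=> s); split=> // i j _.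
  by rewrite !ord1.
split.
  by exists (x ord0); split=> // t /key /hx[_].
move: hp => [T [m [m0 h]]]; exists T, m; split=> // t ht /=.
by rewrite -!key; exact: h.
Qed.

Lemma dot_sum_le (d : nat) (y z : 'rV[nat]_d) :
  (dot (const_mx (-1)) y <= dot (const_mx (-1)) z) =
  (\sum_(l < d) z 0%R l <= \sum_(l < d) y 0%R l)%N.
Proof.
have h (u : 'rV[nat]_d) : dot (const_mx (-1)) u = - (\sum_(l < d) u 0%R l)%N%:Z.
  rewrite /dot (big_morph Posz PoszD (erefl _)) -sumrN.
  by apply: eq_bigr => l _; rewrite mxE mulN1r.
by rewrite !h lerN2.
Qed.

(** With c = (-1, ..., -1), nonzero because d > 0, maximizing c means minimizing the coordinate sum,
    which is possible on every nonempty subset of N^d. *)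
Lemma property3a_property3 (d : nat) (S : nat -> set 'rV[nat]_d) :
  (0 < d)%N -> property3a S -> property3 S.
Proof.
move=> d0 /(_ (const_mx (-1))) [].
  apply/eqP => /matrixP /(_ 0 (Ordinal d0)); rewrite !mxE.
  by move/eqP; rewrite oppr_eq0 oner_eq0.
move=> [x [hx qx]].
have key t : (exists y, maximizes (const_mx (-1)) (S t) y) <-> S t !=set0.
  split=> [[y [hy _]]|[y hy]]; first by exists y.
  have ex : exists n, `[< exists2 z, S t z & n = \sum_(l < d) z 0%R l >]%N.
    by exists (\sum_(l < d) y 0%R l)%N; apply/asboolP; exists y.
  case: (ex_minnP ex) => n /asboolP[z hz ->] hmin; exists z; split=> // u hu.
  by rewrite dot_sum_le; apply: hmin; apply/asboolP; exists u.
move=> hp; split.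
  by exists x; split=> // t /key /hx[].
move: hp => [T [m [m0 h]]]; exists T, m; split=> // t ht /=.
by rewrite -!key; exact: h.
Qed.

(** * Difference operators and rational series *)

Section Differences.

Variable d : nat.
Implicit Types (b u v : 'rV[int]_d) (bs cs : seq 'rV[int]_d) (f g h : laurent d).
Implicit Types s : seq (rat * 'rV[int]_d).

(** Multiplication by 1 - x^b. *)
Definition diff b f : laurent d := fun u => f u - f (u - b).

Definition diffs (bs : seq 'rV[int]_d) f : laurent d := foldr diff f bs.

(** Multiplication by the Laurent polynomial whose terms are the pairs (coefficient, exponent) in s;
    applied to [monomial 0] it gives that polynomial itself. *)
Definition combo (s : seq (rat * 'rV[int]_d)) f : laurent d :=
  fun u => \sum_(x <- s) x.1 * f (u - x.2).

Lemma combo_enum (I : finType) (alpha : I -> rat) (q : I -> 'rV[int]_d) f u :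
  combo [seq (alpha j, q j) | j <- enum I] f u = \sum_j alpha j * f (u - q j).
Proof. by rewrite /combo big_map big_enum. Qed.

Lemma combo_diff s b f : combo s (diff b f) = diff b (combo s f).
Proof.
apply/funext => u; rewrite /combo /diff -sumrB.
by apply: eq_bigr => x _; rewrite mulrBr addrAC.
Qed.

Lemma combo_diffs s bs f : combo s (diffs bs f) = diffs bs (combo s f).
Proof. by elim: bs => //= b bs IH; rewrite combo_diff IH. Qed.

Lemma diff_combo b f : diff b f = combo [:: (1, 0); (-1, b)] f.
Proof.
by apply/funext => u; rewrite /combo big_cons big_seq1 /= mul1r mulN1r subr0.
Qed.

Lemma diffs_diff bs b f : diffs bs (diff b f) = diff b (diffs bs f).
Proof. by rewrite !diff_combo combo_diffs. Qed.

Lemma diffs_cat bs cs f : diffs (bs ++ cs) f = diffs bs (diffs cs f).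
Proof. exact: foldr_cat. Qed.

Lemma diffs_filter (p : pred 'rV[int]_d) bs f :
  diffs bs f = diffs (filter p bs) (diffs (filter (predC p) bs) f).
Proof.
elim: bs => //= b bs ->; case: (p b) => //=.
by rewrite diffs_diff.
Qed.

Definition dotz (c u : 'rV[int]_d) : int := \sum_(l < d) c 0 l * u 0 l.

Lemma dotzD c u v : dotz c (u + v) = dotz c u + dotz c v.
Proof. by rewrite -big_split; apply: eq_bigr => l _; rewrite mxE mulrDr. Qed.

Lemma dotzN c u : dotz c (- u) = - dotz c u.
Proof. by rewrite -sumrN; apply: eq_bigr => l _; rewrite mxE mulrN. Qed.

Lemma dotzB c u v : dotz c (u - v) = dotz c u - dotz c v.
Proof. by rewrite dotzD dotzN. Qed.

Lemma dotz0 c : dotz c 0 = 0.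
Proof. by apply: big1 => l _; rewrite mxE mulr0. Qed.

Lemma dotzMn c u n : dotz c (u *+ n) = dotz c u *+ n.
Proof. by elim: n => [|n IH]; rewrite ?dotz0 // !mulrS dotzD IH. Qed.

Lemma first_nonzero u : u != 0 ->
  exists l, u 0 l != 0 /\ forall l' : 'I_d, (l' < l)%N -> u 0 l' = 0.
Proof.
move=> u0; have [l hl] : exists l, u 0 l != 0.
  apply: contrapT => /forallNP h; move/eqP: u0; apply.
  by apply/rowP => l; rewrite mxE; apply/eqP/negPn/negP/h.
case: (@arg_minnP _ l (fun l => u 0 l != 0) (fun l => l : nat) hl) => k hk hmin; exists k; split=> // l'.
by apply: contraTeq => /hmin; rewrite -leqNgt.
Qed.

Lemma lex_positive_coord b : lex_positive b -> exists l, 0 < b 0 l.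
Proof.
by move=> [/first_nonzero[l [hl hlt]] h]; exists l; apply: h.
Qed.

(** Weights decreasing geometrically with ratio M > d B, where B bounds all entries, let the first
    nonzero entry of each b outweigh the later ones. *)
Lemma lex_positive_functional bs : (forall b, b \in bs -> lex_positive b) ->
  exists c, forall b, b \in bs -> 0 < dotz c b.
Proof.
move=> hbs; pose B := (\max_(b <- bs) \max_(l < d) `|b 0%R l|)%N.
have hB b l : b \in bs -> (`|b 0 l| <= B%:Z)%R.
  move=> hb; rewrite -abszE lez_nat.
  apply: (@leq_trans (\max_(l < d) `|b 0%R l|)%N).
    exact: (leq_bigmax (F := fun l : 'I_d => `|b 0%R l|%N) l).
  exact: (@leq_bigmax_seq _ bs predT (fun b : 'rV[int]_d => \max_(l < d) `|b 0%R l|)%N b hb isT).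
pose M : int := (d * B).+1%:Z.
have M0 : 0 < M by [].
exists (\row_l M ^+ (d - l)) => b hb.
have [b0 /= hpos] := hbs b hb.
have [k [hk hlt]] := first_nonzero b0.
have {hk}hk : 1 <= b 0 k by have := hpos k hk hlt.
(* After the extra factor M, each weight following position k is at most e, while the leading term
   is at least M e = e d B + e. *)
suff : 0 < M * dotz (\row_l M ^+ (d - l)) b by rewrite pmulr_rgt0.
pose e := M ^+ (d - k).
have e0 : 0 < e by apply: exprn_gt0.
rewrite /dotz (bigD1 k) //= mxE -/e mulrDr mulr_sumr.
have le1 : M * e <= M * (e * b 0 k).
  by rewrite ler_pM2l // ler_peMr // ltW.
have le2 : - (e * (d * B)%:Z) <= \sum_(l < d | l != k) M * ((\row_l M ^+ (d - l)) 0 l * b 0 l).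
  have -> : - (e * (d * B)%:Z) = \sum_(l < d) - (e * B%:Z).
    by rewrite sumr_const card_ord -mulr_natr natz PoszM; ring.
  rewrite [leRHS]big_mkcond; apply: ler_sum => l _.
  case: eqVneq => [->|lk]; first by rewrite oppr_le0 mulr_ge0 // ltW.
  have [ltl|gel] := ltnP l k.
    by rewrite hlt // !mulr0 oppr_le0 mulr_ge0 // ltW.
  have ltl : (k < l)%N by rewrite ltn_neqAle gel andbT eq_sym.
  rewrite mxE mulrA -exprS.
  have le3 : M ^+ (d - l).+1 <= e.
    rewrite /e; apply: ler_weXn2l; first by [].
    by have := ltn_ord l; lia.
  have le4 : 0 <= M ^+ (d - l).+1 by rewrite ltW // exprn_gt0.
  rewrite lerNl -mulrN; apply: (le_trans (ler_norm _)).
  rewrite normrM normrN (ger0_norm le4); apply: ler_pM => //.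
  exact: hB.
apply: lt_le_trans (lerD le1 le2).
rewrite subr_gt0 mulrC ltr_pM2r //.
by rewrite /M ltz_nat.
Qed.

(** Such a bound makes the sum of f(u - n b) over n finite as soon as c is positive on b. *)
Definition above (c : 'rV[int]_d) f := exists L : int, forall u, f u != 0 -> L <= dotz c u.

Lemma fsum_nat (F : nat -> rat) N : (forall n, (N <= n)%N -> F n = 0) ->
  \sum_(n \in [set: nat]) F n = \sum_(n < N) F n.
Proof.
move=> h; rewrite fsbig_ord; symmetry; apply: fsbig_widen => // n [_ /= hn].
by apply: h; rewrite leqNgt; apply/negP.
Qed.

Lemma mulrn_inj b : b != 0 -> injective (fun n : nat => b *+ n).
Proof.
move=> /first_nonzero[l [hl _]] n n' /(congr1 (fun u : 'rV[int]_d => u 0 l)).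
by rewrite !mulmxnE => /(mulrIn hl).
Qed.

(** The multiples of a nonzero b are distinct, so the geometric series has coefficient 1 at each of
    them and 0 elsewhere. *)
Lemma mul_geometric b f u : b != 0 ->
  laurent_mul (geometric b) f u = \sum_(n \in [set: nat]) f (u - b *+ n).
Proof.
move=> b0; rewrite /laurent_mul.
have gE n : geometric b (b *+ n) = 1.
  rewrite /geometric /monomial -(@fsbig_widen _ _ _ _ [set n]) ?fsbig_set1 ?eqxx //.
  by move=> n' [_ /= hn]; case: eqP => // /(mulrn_inj b0) h; case: hn.
rewrite -(@fsbig_widen _ _ _ _ (range (fun n => b *+ n))) //; last first.
  move=> v [_ /= hv]; rewrite /geometric fsbig1 ?mul0r // => n _.
  by rewrite /monomial; case: eqP => // hvn; case: hv; exists n.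
rewrite fsbig_image; last by move=> n n' _ _; apply: mulrn_inj.
by apply: eq_fsbigr => n _; rewrite gE mul1r.
Qed.

Lemma above_vanish c f b : above c f -> 0 < dotz c b ->
  forall u, exists N, forall n, (N <= n)%N -> f (u - b *+ n) = 0.
Proof.
move=> [L hL] cb u; exists (`|dotz c u - L|%N.+1) => n hn.
apply/eqP; apply: contraTT hn => /hL; rewrite dotzB dotzMn -ltnNge ltnS.
by rewrite -mulr_natr => h; nia.
Qed.

Lemma diff_mul_geometric c f b : above c f -> 0 < dotz c b ->
  diff b (laurent_mul (geometric b) f) = f.
Proof.
move=> hf cb; have b0 : b != 0.
  by apply: contraTneq cb => ->; rewrite dotz0.
apply/funext => u; rewrite /diff !mul_geometric //.
have [N hN] := above_vanish hf cb u.
(* The truncations have lengths N + 1 and N, so that after the shift by b only the term n = 0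
   survives. *)
rewrite (@fsum_nat _ N.+1) => [|n hn]; last by rewrite hN // ltnW.
rewrite (@fsum_nat _ N) => [|n hn].
  rewrite big_ord_recl mulr0n subr0 (eq_bigr (fun n : 'I_N => f (u - b - b *+ n))) ?addrK //.
  by move=> n _; rewrite lift0 mulrS opprD addrA.
by rewrite -addrA -opprD -mulrS hN // ltnW.
Qed.

Lemma above_mul_geometric c f b : above c f -> 0 < dotz c b ->
  above c (laurent_mul (geometric b) f).
Proof.
move=> [L hL] cb; have b0 : b != 0.
  by apply: contraTneq cb => ->; rewrite dotz0.
exists L => u; rewrite mul_geometric // => h.
have [n hn] : exists n, f (u - b *+ n) != 0.
  apply: contrapT => /forallNP hn; move/eqP: h; apply.
  by apply: fsbig1 => n _; apply/eqP/negPn/negP/hn.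
by have := hL _ hn; rewrite dotzB dotzMn -mulr_natr; nia.
Qed.

Lemma fsum_single v (F : 'rV[int]_d -> rat) :
  \sum_(u \in [set: 'rV[int]_d]) (u == v)%:R * F u = F v.
Proof.
rewrite -(@fsbig_widen _ _ _ _ [set v]) ?fsbig_set1 ?eqxx ?mul1r // => u [_ /= h].
by case: eqP => [//|_]; rewrite mul0r.
Qed.

Lemma fsum_combo s (F : 'rV[int]_d -> rat) :
  \sum_(u \in [set: 'rV[int]_d]) combo s (monomial 0) u * F u =
  \sum_(x <- s) x.1 * F x.2.
Proof.
(* Exponents may repeat in s: the support is listed once, and exchanging the sums collects equal
   exponents. *)
set r := undup (map snd s).
rewrite -(@fsbig_widen _ _ _ _ [set` r]) //; last first.
  move=> u [_ /= hu]; rewrite /combo big1_seq ?mul0r // => x /= hx.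
  rewrite /monomial subr_eq0; case: eqP => [ux|_]; last by rewrite mulr0.
  by case: hu; rewrite mem_undup ux map_f.
rewrite -fsbig_seq ?undup_uniq //.
under eq_bigr do rewrite mulr_suml.
rewrite exchange_big /= big_seq [RHS]big_seq; apply: eq_bigr => x hx.
rewrite (bigD1_seq x.2) ?undup_uniq //=; last by rewrite mem_undup map_f.
rewrite /monomial subrr eqxx mulr1 big1 ?addr0 // => u /negbTE ux.
by rewrite subr_eq0 ux mulr0 mul0r.
Qed.

Lemma mul_combo s f : laurent_mul (combo s (monomial 0)) f = combo s f.
Proof. by apply/funext => u; rewrite /laurent_mul fsum_combo. Qed.

(** Each 1 - x^b cancels one geometric factor. A linear form positive on all the b keeps every
    partial product supported above a bound, which justifies the cancellation. *)
Lemma diffs_rational_series (n k : nat) (alpha : 'I_n -> rat)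
    (q : 'I_n -> 'rV[int]_d) (b : 'I_k -> 'rV[int]_d) :
  (forall j, lex_positive (b j)) ->
  diffs [seq b j | j <- enum 'I_k] (rational_series alpha q b) =
  combo [seq (alpha j, q j) | j <- enum 'I_n] (monomial 0).
Proof.
move=> hb; have [c hc] : exists c, forall v, v \in [seq b j | j <- enum 'I_k] -> 0 < dotz c v.
  by apply: lex_positive_functional => v /mapP[j _ ->].
have {}hc j : 0 < dotz c (b j) by apply: hc; rewrite map_f ?mem_enum.
have -> : rational_series alpha q b =
    combo [seq (alpha j, q j) | j <- enum 'I_n]
      (\big[@laurent_mul d / monomial 0]_(j < k) geometric (b j)).
  rewrite -mul_combo /rational_series; congr laurent_mul.
  apply/funext => u; rewrite combo_enum.
  by apply: eq_bigr => j _; rewrite /monomial subr_eq0.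
rewrite -combo_diffs; congr combo.
have [] : above c (\big[@laurent_mul d / monomial 0]_(j <- enum 'I_k) geometric (b j)) /\
  diffs [seq b j | j <- enum 'I_k]
    (\big[@laurent_mul d / monomial 0]_(j <- enum 'I_k) geometric (b j)) = monomial 0.
  elim: (enum 'I_k) => [|j js [IH1 IH2]] /=.
    rewrite big_nil; split=> //; exists 0 => u.
    by rewrite /monomial; case: (u =P 0) => [-> _|_]; rewrite ?dotz0 ?eqxx.
  rewrite big_cons; split; first exact: above_mul_geometric.
  by rewrite -diffs_diff (diff_mul_geometric IH1).
by rewrite enumT /index_enum !unlock.
Qed.

End Differences.

(** * Generating series as germs *)

Section GeneratingSeries.

Variable d : nat.
Implicit Types (A : set 'rV[nat]_d) (s : 'rV[nat]_d) (u : 'rV[int]_d).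

Lemma map_Posz_inj : injective (map_mx Posz : 'rV[nat]_d -> 'rV[int]_d).
Proof.
move=> s s' /rowP h; apply/rowP => l; have := h l.
by rewrite !mxE => -[].
Qed.

Lemma generating_seriesE A u :
  generating_series A u = `[< exists2 s, A s & u = map_mx Posz s >]%:R.
Proof.
rewrite /generating_series /monomial.
case: asboolP => [[s hs ->]|no]; last first.
  by apply: fsbig1 => s hs; case: eqP => // hu; case: no; exists s.
rewrite -(@fsbig_widen _ _ _ _ [set s]) ?fsbig_set1 ?eqxx //.
  by move=> s' /= ->.
by move=> s' [_ /= hn]; case: eqP => // /map_Posz_inj h; case: hn.
Qed.

Lemma generating_series_neq0 A u :
  generating_series A u != 0 -> exists2 s, A s & u = map_mx Posz s.
Proof. by rewrite generating_seriesE; case: asboolP => //; rewrite eqxx. Qed.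

Lemma generating_series_in A s : A s -> generating_series A (map_mx Posz s) = 1.
Proof. by move=> hs; rewrite generating_seriesE asboolT //; exists s. Qed.

Lemma generating_series_ge0 A u : 0 <= generating_series A u.
Proof. by rewrite generating_seriesE ler0n. Qed.

Lemma generating_seriesD1 A s : A s ->
  generating_series (A `\ s) =
  fun u => generating_series A u - monomial (map_mx Posz s) u.
Proof.
move=> hs; apply/funext => u; rewrite !generating_seriesE /monomial.
case: eqP => [->|us].
  rewrite asboolF; last by move=> [s' [_ /= h] /map_Posz_inj e]; apply: h.
  by rewrite asboolT ?subrr //; exists s.
rewrite subr0; congr (_%:R); congr nat_of_bool; apply: asbool_equiv_eq.
split=> [[s' [hs' _] ->]|[s' hs' hu]]; first by exists s'.
by exists s' => //; split=> // /= h; apply: us; rewrite hu h.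
Qed.

End GeneratingSeries.

(** * Vectors, Laurent polynomials and rational series varying with t *)

Section VectorGerms.

Variables (m i d : nat).
Implicit Types q r : nat -> 'rV[int]_d.

Definition germ_vec q := forall l, germ_poly m i (fun t => (q t 0 l)%:~R).

Lemma vec_cst (v : 'rV[int]_d) : germ_vec (fun=> v).
Proof. by move=> l; apply: poly_cst. Qed.

Lemma vec_add q r : germ_vec q -> germ_vec r -> germ_vec (fun t => q t + r t).
Proof.
move=> hq hr l; apply: poly_ext (poly_add (hq l) (hr l)) => t.
by rewrite mxE rmorphD.
Qed.

Lemma vec_opp q : germ_vec q -> germ_vec (fun t => - q t).
Proof.
move=> hq l; apply: poly_ext (poly_opp (hq l)) => t.
by rewrite mxE rmorphN.
Qed.

Lemma vec_sub q r : germ_vec q -> germ_vec r -> germ_vec (fun t => q t - r t).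
Proof. by move=> hq hr; apply: vec_add hq (vec_opp hr). Qed.

Lemma vec_sum (I : Type) (s : seq I) (q : I -> nat -> 'rV[int]_d) :
  (forall j, germ_vec (q j)) -> germ_vec (fun t => \sum_(j <- s) q j t).
Proof.
move=> h l; apply: poly_ext (poly_sum s (fun j => h j l)) => t.
by rewrite summxE rmorph_sum.
Qed.

Lemma vec_if (b : nat -> bool) q r : germ_dec m i b ->
  germ_vec q -> germ_vec r -> germ_vec (fun t => if b t then q t else r t).
Proof.
move=> hb hq hr l; apply: poly_ext (poly_if hb (hq l) (hr l)) => t.
by case: (b t).
Qed.

Lemma poly_dotz (c : nat -> 'rV[int]_d) q : germ_vec c -> germ_vec q ->
  germ_poly m i (fun t => (dotz (c t) (q t))%:~R).
Proof.
move=> hc hq; apply: poly_ext (poly_sum (index_enum 'I_d) (fun l => poly_mul (hc l) (hq l))) => t.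
by rewrite rmorph_sum; apply: eq_bigr => l _; rewrite rmorphM.
Qed.

Lemma dec_eq_vec q r : germ_vec q -> germ_vec r ->
  germ_dec m i (fun t => q t = r t).
Proof.
move=> hq hr; apply: dec_ext (dec_forall (fun l => dec_eq (hq l) (hr l))) => t.
split=> [h|-> //]; apply/rowP => l; apply/eqP.
by rewrite -(eqr_int rat) h.
Qed.

(** The number of terms and the coefficients are fixed, only the exponents move; exponents may
    coincide for some t. *)
Definition laurent_germ (N : nat -> laurent d) : Prop :=
  exists (I : finType) (alpha : I -> rat) (q : I -> nat -> 'rV[int]_d),
    (forall j, germ_vec (q j)) /\
    near_class m i (fun t =>
      N t = combo [seq (alpha j, q j t) | j <- enum I] (monomial 0)).

(** Property 4 on one class with the denominators cleared, so that no expansion is involved any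
    more. *)
Definition rational_germ (f : nat -> laurent d) : Prop :=
  exists (k : nat) (b : 'I_k -> nat -> 'rV[int]_d),
    [/\ forall j, germ_vec (b j),
        near_class m i (fun t => forall j, lex_positive (b j t)) &
        laurent_germ (fun t => diffs [seq b j t | j <- enum 'I_k] (f t))].

Lemma laurent_near (N N' : nat -> laurent d) :
  near_class m i (fun t => N t = N' t) -> laurent_germ N -> laurent_germ N'.
Proof.
move=> h [I [a [q [hq hN]]]]; exists I, a, q; split=> //.
by apply: near_mono2 h hN => t ->.
Qed.

Lemma laurent_sub (N N' : nat -> laurent d) :
  laurent_germ N -> laurent_germ N' ->
  laurent_germ (fun t => fun u => N t u - N' t u).
Proof.
move=> [I [a [q [hq hN]]]] [J [a' [q' [hq' hN']]]].
exists (I + J)%type, (fun j => match j with inl j => a j | inr j => - a' j end),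
  (fun j => match j with inl j => q j | inr j => q' j end).
split; first by case.
apply: near_mono2 hN hN' => t -> ->; apply/funext => u.
rewrite !combo_enum big_sumType /= -sumrN; congr (_ + _).
by apply: eq_bigr => j _; rewrite mulNr.
Qed.

Lemma laurent_diff (b : nat -> 'rV[int]_d) (N : nat -> laurent d) :
  germ_vec b -> laurent_germ N -> laurent_germ (fun t => diff (b t) (N t)).
Proof.
move=> hb hN; apply: (laurent_sub hN).
case: hN => I [a [q [hq hN]]].
exists I, a, (fun j t => q j t + b t); split=> [j|]; first exact: vec_add.
apply: near_mono hN => t ->; apply/funext => u.
rewrite !combo_enum; apply: eq_bigr => j _ /=.
by rewrite opprD addrA [u - q j t - _]addrAC.
Qed.

Lemma laurent_diffs (k : nat) (b : 'I_k -> nat -> 'rV[int]_d) (N : nat -> laurent d) :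
  (forall j, germ_vec (b j)) -> laurent_germ N ->
  laurent_germ (fun t => diffs [seq b j t | j <- enum 'I_k] (N t)).
Proof.
by move=> hb hN; elim: (enum 'I_k) => //= j js IH; apply: laurent_diff.
Qed.

Lemma laurent_monomial q : germ_vec q -> laurent_germ (fun t => monomial (q t)).
Proof.
move=> hq; exists unit, (fun=> 1), (fun=> q); split=> //.
apply: near_all => t; apply/funext => u.
by rewrite combo_enum big_const card_unit /= mul1r addr0 /monomial subr_eq0.
Qed.

Lemma diffs_sub bs (f g : laurent d) :
  diffs bs (fun u => f u - g u) = fun u => diffs bs f u - diffs bs g u.
Proof.
elim: bs => //= b bs ->; apply/funext => u; rewrite /diff.
by ring.
Qed.

(** This removes one point q(t) from S_t: the same denominators turn its monomial into a Laurent
    polynomial. *)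
Lemma rational_sub_monomial (f : nat -> laurent d) q :
  germ_vec q -> rational_germ f ->
  rational_germ (fun t => fun u => f t u - monomial (q t) u).
Proof.
move=> hq [k [b [hb hpos hN]]]; exists k, b; split=> //.
apply: laurent_near (laurent_sub hN (laurent_diffs hb (laurent_monomial hq))).
by apply: near_all => t; rewrite diffs_sub.
Qed.

Lemma rational_near (f g : nat -> laurent d) :
  near_class m i (fun t => f t = g t) -> rational_germ f -> rational_germ g.
Proof.
move=> h [k [b [hb hpos hN]]]; exists k, b; split=> //.
by apply: laurent_near hN; apply: near_mono h => t ->.
Qed.

End VectorGerms.

Lemma property4_germ (d : nat) (S : nat -> set 'rV[nat]_d) : property4 S ->
  exists m : nat, (0 < m)%N /\
  forall i : 'I_m, rational_germ m i (fun t => generating_series (S t)).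
Proof.
move=> [m [m0 h]]; exists m; split=> // i.
have [n [k [alpha [q [b [T hT]]]]]] := h i.
(* The integer vectors exist separately for each t; taking floors of the polynomial values recovers
   them as functions of t. *)
pose fl (p : 'rV[{poly rat}]_d) t : 'rV[int]_d := \row_l Num.floor (p 0 l).[t%:R].
have flE p t v : evaluates_to p t v -> v = fl p t.
  by move=> hp; apply/rowP => l; rewrite mxE hp intrKfloor.
have flV (p : 'rV[{poly rat}]_d) : near_class m i (fun t => exists v, evaluates_to p t v) ->
    germ_vec m i (fl p).
  move=> hp l; exists (p 0 l); apply: near_mono hp => t [v hv].
  by rewrite -(flE _ _ _ hv) hv.
exists k, (fun j => fl (b j)); split.
- move=> j; apply: flV; exists T => t ht /(hT t ht)[qt [bt [_ hb _ _]]].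
  by exists (bt j).
- exists T => t ht /(hT t ht)[qt [bt [_ hb hpos _]]] j.
  by rewrite -(flE _ _ _ (hb j)).
exists 'I_n, alpha, (fun j => fl (q j)); split.
  move=> j; apply: flV; exists T => t ht /(hT t ht)[qt [bt [hq _ _ _]]].
  by exists (qt j).
exists T => t ht /(hT t ht)[qt [bt [hq hb hpos ->]]].
have -> : [seq fl (b j) t | j <- enum 'I_k] = [seq bt j | j <- enum 'I_k].
  by apply: eq_map => j; rewrite -(flE _ _ _ (hb j)).
rewrite diffs_rational_series //; congr (combo _ _).
by apply: eq_map => j; rewrite -(flE _ _ _ (hq j)).
Qed.

(** * Leading exponents *)

Section Leading.

Variable d : nat.
Implicit Types (u v b c s : 'rV[int]_d) (cs bs : seq 'rV[int]_d) (f g : laurent d).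

(* The order u < v iff [posl cs (v - u)] compares the values of the linear forms
   in cs lexicographically; it is a total group order when cs is separating. *)
Fixpoint posl cs u : bool :=
  if cs is c :: cs then (0 < dotz c u) || (dotz c u == 0) && posl cs u else false.

Definition separating cs := forall u, (forall c, c \in cs -> dotz c u = 0) -> u = 0.

Lemma poslD cs u v : posl cs u -> posl cs v -> posl cs (u + v).
Proof.
elim: cs => //= c cs IH; rewrite dotzD.
move=> /orP[h|/andP[/eqP h hu]] /orP[h'|/andP[/eqP h' hv]]; rewrite ?h ?h'.
- by rewrite addr_gt0.
- by rewrite addr0 h.
- by rewrite add0r h'.
- by rewrite addr0 eqxx IH ?orbT.
Qed.

Lemma posl0 cs : posl cs 0 = false.
Proof. by elim: cs => //= c cs ->; rewrite dotz0 ltxx andbF. Qed.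

Lemma posl_asym cs u : posl cs u -> posl cs (- u) -> False.
Proof. by move=> hu /(poslD hu); rewrite subrr posl0. Qed.

Lemma posl_total cs u : separating cs -> u != 0 -> posl cs u || posl cs (- u).
Proof.
move=> hcs; apply: contraNT => h; apply/eqP/hcs.
elim: cs h {hcs} => //= c cs IH; rewrite dotzN oppr_gt0 oppr_eq0.
case: ltgtP => //= h /IH{}IH v; rewrite inE => /orP[/eqP->|/IH] //.
Qed.

Definition lead cs f s := f s != 0 /\ forall u, f u != 0 -> u != s -> posl cs (s - u).

Lemma lead_uniq cs f s s' : lead cs f s -> lead cs f s' -> s = s'.
Proof.
move=> [hs h] [hs' h']; apply: contrapT => /eqP ss'.
have h1 := h' _ hs ss'; rewrite eq_sym in ss'.
by apply: (posl_asym h1); rewrite opprB; apply: h.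
Qed.

Lemma diff_neq0 b f u : diff b f u != 0 -> f u != 0 \/ f (u - b) != 0.
Proof.
rewrite /diff; have [->|] := eqVneq (f u) 0; last by left.
by rewrite sub0r oppr_eq0; right.
Qed.

(** Of f and its translate by b, the one with the larger top exponent keeps it uncancelled: the
    translate if b is positive, f itself otherwise. *)
Lemma lead_diff cs b f s : separating cs -> b != 0 -> lead cs f s ->
  lead cs (diff b f) (s + if posl cs b then b else 0).
Proof.
move=> hcs b0 [hs h].
have vanish u : posl cs (u - s) -> f u = 0.
  move=> hu; apply/eqP; apply: contraT => fu; exfalso.
  have us : u != s by apply: contraTneq hu => ->; rewrite subrr posl0.
  by apply: (posl_asym hu); rewrite opprB; apply: h.
case: ifP => hb.
  split; first by rewrite /diff addrK vanish ?sub0r ?oppr_eq0 // addrC addKr.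
  move=> u /diff_neq0[fu|fu] us; rewrite addrAC addrC.
    have [->|us'] := eqVneq u s; first by rewrite subrr addr0.
    by apply: (poslD hb); apply: h.
  have -> : b + (s - u) = s - (u - b) by rewrite opprB addrCA.
  by apply: h => //; rewrite subr_eq.
have {}hb : posl cs (- b) by have := posl_total hcs b0; rewrite hb.
rewrite addr0; split.
  by rewrite /diff [f (s - b)]vanish ?subr0 // addrAC subrr add0r.
move=> u /diff_neq0[fu|fu] us; first exact: h.
have [us'|us'] := eqVneq (u - b) s.
  by rewrite -us' addrAC subrr add0r.
have -> : s - u = (s - (u - b)) + - b by rewrite opprB -addrA addrAC subrr add0r.
by apply: poslD => //; apply: h.
Qed.

Lemma lead_diffs cs bs f s : separating cs -> (forall b, b \in bs -> b != 0) ->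
  lead cs f s ->
  lead cs (diffs bs f) (s + \sum_(b <- bs) if posl cs b then b else 0).
Proof.
move=> hcs; elim: bs => [|b bs IH] hb hf; first by rewrite big_nil addr0.
rewrite big_cons addrCA addrC; apply: lead_diff => //.
  by apply: hb; rewrite mem_head.
by apply: IH => // b' hb'; apply: hb; rewrite inE hb' orbT.
Qed.

Lemma int_set_max (T : Type) (A : set T) (F : T -> int) (M : int) :
  A !=set0 -> (forall x, A x -> F x <= M) ->
  exists x, A x /\ forall y, A y -> F y <= F x.
Proof.
move=> [x0 hx0] hM.
have ex : exists n, `[< exists2 x, A x & M - F x = n%:Z >].
  exists `|M - F x0|%N; apply/asboolP; exists x0 => //.
  by rewrite gez0_abs // subr_ge0 hM.
case: (ex_minnP ex) => n /asboolP[x hx hn] hmin; exists x; split=> // y hy.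
have : (n <= `|M - F y|)%N.
  by apply: hmin; apply/asboolP; exists y; rewrite // gez0_abs // subr_ge0 hM.
by rewrite -lez_nat gez0_abs ?subr_ge0 ?hM // -hn lerD2l lerN2.
Qed.

(** Maximize the first form, then repeat with the remaining forms on the set of its maximizers. *)
Lemma lex_max_exists cs (A : set 'rV[int]_d) : A !=set0 ->
  (forall c, c \in cs -> exists M, forall u, A u -> dotz c u <= M) ->
  exists s, A s /\ forall u, A u ->
    posl cs (s - u) \/ forall c, c \in cs -> dotz c (s - u) = 0.
Proof.
elim: cs A => [|c cs IH] A A0 hA.
  by case: A0 => s hs; exists s; split=> // u _; right.
have [M hM] := hA c (mem_head _ _).
have [s0 [hs0 hmax]] := int_set_max A0 hM.
have [||s [[hs hcs] h]] := IH [set u | A u /\ dotz c u = dotz c s0].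
- by exists s0.
- move=> c' hc'; have [|M' hM'] := hA c'; first by rewrite inE hc' orbT.
  by exists M' => u [/hM'].
exists s; split=> // u hu /=; rewrite dotzB hcs.
have := hmax u hu; rewrite le_eqVlt => /orP[/eqP e|lt]; last first.
  by left; rewrite subr_gt0 lt.
have [|h1|h1] := h u; first by split.
  by left; rewrite e subrr eqxx h1 orbT.
right=> c'; rewrite inE => /orP[/eqP->|/h1 //].
by rewrite dotzB hcs e subrr.
Qed.

Lemma lead_exists cs f : separating cs -> (exists u, f u != 0) ->
  (forall c, c \in cs -> exists M, forall u, f u != 0 -> dotz c u <= M) ->
  exists s, lead cs f s.
Proof.
move=> hcs f0 hf.
have [s [hs h]] := @lex_max_exists cs [set u | f u != 0] f0 hf.
exists s; split=> // u fu us; case: (h u fu) => // /hcs /eqP.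
by rewrite subr_eq0 eq_sym (negbTE us).
Qed.

End Leading.

(** * Leading exponents as functions of t *)

Section LeadingGerm.

Variables (m i d : nat).

Lemma poly_indicator (P : nat -> Prop) (F : nat -> rat) :
  germ_dec m i P -> germ_poly m i F ->
  germ_poly m i (fun t => if `[< P t >] then F t else 0).
Proof.
move=> hP hF; apply: poly_if (poly_cst _ _ 0) => //.
by apply: dec_ext hP => t; split=> /asboolP.
Qed.

Lemma dec_posl (cs : seq 'rV[int]_d) (q : nat -> 'rV[int]_d) :
  germ_vec m i q -> germ_dec m i (fun t => posl cs (q t)).
Proof.
move=> hq; elim: cs => [|c cs IH]; first by right; apply: near_all.
have hc := poly_dotz (vec_cst m i c) hq.
apply: dec_ext (dec_or (dec_gt0 hc) (dec_and (dec_eq0 hc) IH)) => t /=.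
rewrite ltr0z; split=> [[->//|[/eqP]]|].
  by rewrite intr_eq0 => -> ->; rewrite orbT.
case/orP=> [h|/andP[/eqP h h']]; first by left.
by right; rewrite h.
Qed.

(** The only candidates are the q_j(t), and whether q_j(t) leads is eventually decided. If none
    eventually does, the finite support of N_t must be empty. *)
Lemma laurent_lead (cs : seq 'rV[int]_d) (N : nat -> laurent d) :
  separating cs -> laurent_germ m i N ->
  near_class m i (fun t => forall u, N t u = 0) \/
  exists q, germ_vec m i q /\ near_class m i (fun t => lead cs (N t) (q t)).
Proof.
move=> hcs [I [a [q [hq hN]]]].
(* Terms may cancel: the coefficient at q_j(t) sums the alpha_k over all k with q_k(t) = q_j(t), a
   condition which is itself decided. *)
have dec0 j : germ_dec m i (fun t => N t (q j t) != 0).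
  have hp : germ_poly m i (fun t => N t (q j t)).
    pose F t := \sum_(k : I) if `[< q j t = q k t >] then a k else 0.
    apply: (@poly_near _ _ F).
      apply: near_mono hN => t ->; rewrite combo_enum; apply: eq_bigr => k _.
      rewrite /monomial subr_eq0; case: asboolP => [->|]; first by rewrite eqxx mulr1.
      by move=> /eqP/negbTE->; rewrite mulr0.
    apply: poly_sum => k; apply: poly_indicator; last exact: poly_cst.
    exact: dec_eq_vec.
  by apply: dec_ext (dec_not (dec_eq0 hp)) => t; split=> /eqP.
have supp : near_class m i (fun t => forall u, N t u != 0 -> exists j, u = q j t).
  apply: near_mono hN => t -> u h; apply: contrapT => /forallNP no; move/eqP: h; apply.
  rewrite combo_enum big1 // => j _; rewrite /monomial subr_eq0.
  by case: eqP => [/no//|]; rewrite mulr0.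
pose P j t := N t (q j t) != 0 /\ forall k, N t (q k t) != 0 -> q k t <> q j t ->
  posl cs (q j t - q k t).
have decP j : germ_dec m i (P j).
  apply: dec_and => //; apply: dec_forall => k; apply: dec_imp => //; apply: dec_imp.
    by apply: dec_not; apply: dec_eq_vec.
  by apply: dec_posl; apply: vec_sub.
case: (pselect (exists j, near_class m i (P j))) => [[j hj]|no].
  right; exists (q j); split=> //; apply: near_mono2 hj supp => t [h0 h] hs.
  by split=> // u hu; case: (hs u hu) => k e; rewrite e in hu *; move=> /eqP; apply: h.
left; have nP : near_class m i (fun t => forall j, ~ P j t).
  apply: near_forall => j; case: (decP j) => // hj.
  by case: no; exists j.
apply: near_mono2 nP supp => t hno hs u; apply/eqP; apply: contraT => hu; exfalso.
have [||s [hs0 hs1]] := @lead_exists d cs (N t) hcs.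
- by exists u.
- move=> c _; exists (\sum_j `|dotz c (q j t)|) => v /hs[j ->].
  rewrite (bigD1 j) //= (le_trans (ler_norm _)) // lerDl sumr_ge0 // => k _.
- have [j e] := hs s hs0; apply: (hno j); rewrite /P -e; split=> // k hk /eqP hne.
  exact: hs1.
Qed.

Lemma rational_lead (cs : seq 'rV[int]_d) (f : nat -> laurent d) :
  separating cs -> rational_germ m i f ->
  exists x, germ_vec m i x /\
    near_class m i (fun t => forall s, lead cs (f t) s -> s = x t).
Proof.
move=> hcs [k [b [hb hpos /(laurent_lead hcs)[h0|[q [hq hlead]]]]]].
  exists (fun=> 0); split; first exact: vec_cst.
  apply: near_mono2 hpos h0 => t hp hN s /(lead_diffs (bs := [seq b j t | j <- enum 'I_k]) hcs)[].
    by move=> v /mapP[j _ ->]; case: (hp j).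
  by rewrite hN eqxx.
exists (fun t => q t - \sum_(j <- enum 'I_k) if posl cs (b j t) then b j t else 0).
split.
  apply: vec_sub => //; apply: vec_sum => j; apply: vec_if => //.
    exact: dec_posl.
  exact: vec_cst.
apply: near_mono2 hpos hlead => t hp hl s hs.
rewrite -(lead_uniq (lead_diffs hcs _ hs) hl); last by move=> v /mapP[j _ ->]; case: (hp j).
by rewrite big_map addrK.
Qed.

(** A leading exponent survives the difference operators in shifted form. Requiring one excludes
    series such as the sum of x^(n b) over all integers n, which 1 - x^b annihilates. *)
Lemma rational_nonzero (cs : seq 'rV[int]_d) (f : nat -> laurent d) :
  separating cs -> rational_germ m i f ->
  near_class m i (fun t => (exists u, f t u != 0) -> exists s, lead cs (f t) s) ->
  germ_dec m i (fun t => exists u, f t u != 0).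
Proof.
move=> hcs [k [b [hb hpos hN]]] hlead.
case: (laurent_lead hcs hN) => [h0|[q [_ hq]]].
  right; apply: near_mono2 (near_and hpos h0) hlead => t [hp hz] /[apply] -[s].
  move=> /(lead_diffs (bs := [seq b j t | j <- enum 'I_k]) hcs)[].
    by move=> v /mapP[j _ ->]; case: (hp j).
  by rewrite hz eqxx.
left; apply: near_mono hq => t [hs _]; apply: contrapT => /forallNP no.
have f0 : f t = fun=> 0.
  by apply/funext => u; apply/eqP/negPn/negP/no.
move/eqP: hs; apply; rewrite f0.
elim: [seq _ | _ <- _] (q t) => //= c bs IH u.
by rewrite /diff !IH subrr.
Qed.

End LeadingGerm.

(** * Moments along lines *)

Section Moments.

Variable d : nat.
Implicit Types (u v w b c x : 'rV[int]_d) (bs : seq 'rV[int]_d).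
Implicit Types (f h : laurent d) (p : {poly rat}).

(** Proportionality as vanishing of the 2 by 2 minors, a polynomial condition. The vector 0 is
    parallel to everything, so transitivity asks for a nonzero middle vector. *)
Definition par w x : bool := [forall k, forall l, w 0 k * x 0 l == w 0 l * x 0 k].

Lemma parP w x : reflect (forall k l, w 0 k * x 0 l = w 0 l * x 0 k) (par w x).
Proof.
apply: (iffP idP) => [/forallP h k l|h].
  by apply/eqP; move/forallP: (h k) => /(_ l).
by apply/forallP => k; apply/forallP => l; apply/eqP.
Qed.

Lemma par_refl w : par w w.
Proof. by apply/parP => k l; rewrite mulrC. Qed.

Lemma par_sym w x : par w x = par x w.
Proof.
by apply/parP/parP => h k l; rewrite [LHS]mulrC [RHS]mulrC h.
Qed.

Lemma parD w x y : par w x -> par w y -> par w (x + y).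
Proof. by move=> /parP hx /parP hy; apply/parP => k l; rewrite !mxE !mulrDr hx hy. Qed.

Lemma parN w x : par w (- x) = par w x.
Proof.
have h y : par w y -> par w (- y).
  by move=> /parP h; apply/parP => k l; rewrite !mxE !mulrN h.
by apply/idP/idP => /h; rewrite ?opprK.
Qed.

Lemma parB w x y : par w x -> par w y -> par w (x - y).
Proof. by move=> hx hy; apply: parD; rewrite ?parN. Qed.

Lemma parMn w x n : par w x -> par w (x *+ n).
Proof.
move=> hx; elim: n => [|n IH]; last by rewrite mulrS parD.
by apply/parP => k l; rewrite !mxE !mulr0.
Qed.

Lemma par_Mn w x n : (0 < n)%N -> par w (x *+ n) -> par w x.
Proof.
move=> n0 /parP h; apply/parP => k l; have := h k l.
rewrite !mulmxnE !mulrnAr => /eqP; rewrite eqrMn2r; case: n n0 {h} => //= n _.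
by move=> /eqP.
Qed.

Lemma par_trans w b x : b != 0 -> par w b -> par b x -> par w x.
Proof.
move=> /first_nonzero[l [hl _]] /parP hw /parP hb; apply/parP => k k'.
apply: (mulfI hl); have h1 := hw l k; have h2 := hw l k'; have h3 := hb k k'.
have e1 : b 0 l * (w 0 k * x 0 k') = w 0 l * (b 0 k * x 0 k').
  by rewrite mulrA [b 0 l * _]mulrC -h1 mulrA.
have e2 : b 0 l * (w 0 k' * x 0 k) = w 0 l * (b 0 k' * x 0 k).
  by rewrite mulrA [b 0 l * _]mulrC -h2 mulrA.
by rewrite e1 e2 h3.
Qed.

Lemma par_primitive b : b != 0 ->
  exists w (g : nat), [/\ (0 < g)%N, b = w *+ g &
    forall x, par b x -> exists n : int, x = w *~ n].
Proof.
move=> b0; have [l [hl _]] := first_nonzero b0.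
have inj x : par b x -> x 0 l = 0 -> x = 0.
  move=> /parP h xl; apply/rowP => k; rewrite mxE; apply: (mulfI hl).
  by rewrite h xl !mulr0.
(* Take w parallel to b with least positive l-th entry; division with remainder on that entry shows
   that w generates all vectors parallel to b. *)
have ex : exists n, `[< (0 < n)%N /\ exists2 x, par b x & x 0 l = n%:Z >].
  exists `|b 0%R l|%N; apply/asboolP; split; first by rewrite absz_gt0.
  have [h|h] := lerP 0 (b 0 l).
    by exists b; [exact: par_refl|rewrite gez0_abs].
  exists (- b); first by rewrite parN par_refl.
  by rewrite mxE ltz0_abs.
case: (ex_minnP ex) => n /asboolP[n0 [w hw wl]] hmin.
have div x : par b x -> exists z : int, x = w *~ z.
  move=> hx; exists (x 0%R l %/ n)%Z.
  have hpar : par b (x - w *~ (x 0%R l %/ n)%Z).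
    apply: parB => //; case: (x 0%R l %/ n)%Z => z; first by rewrite -pmulrn parMn.
    by rewrite NegzE mulrNz parN -pmulrn parMn.
  apply/eqP; rewrite -subr_eq0; apply/eqP; apply: inj => //.
  have hmod : (x - w *~ (x 0%R l %/ n)%Z) 0 l = (x 0%R l %% n)%Z.
    rewrite !mxE; have -> : (w *~ (x 0%R l %/ n)%Z) 0 l = w 0 l *~ (x 0%R l %/ n)%Z.
      case: (x 0%R l %/ n)%Z => z; rewrite ?NegzE ?mulrNz -?pmulrn ?mxE ?mulmxnE //.
    by rewrite wl -mulrzr intz [in LHS]mulrC /modz.
  rewrite hmod; have n0' : n%:Z != 0 by rewrite eqz_nat -lt0n.
  have h0 := modz_ge0 (x 0 l) n0'.
  have h1 := ltz_pmod (x 0 l) (n0 : 0 < n%:Z).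
  apply/eqP; apply: contraT => hne; exfalso.
  suff : (n <= `|(x 0%R l %% n)%Z|)%N by rewrite -lez_nat gez0_abs // leNgt h1.
  apply: hmin; apply/asboolP; split; first by rewrite absz_gt0.
  by exists (x - w *~ (x 0%R l %/ n)%Z) => //; rewrite hmod gez0_abs.
have [z hz] := div b (par_refl b).
have z0 : z != 0 by apply: contra_neq b0 => z0; rewrite hz z0.
have [zpos|zneg] := ltrP 0 z.
  exists w, `|z|%N; split; rewrite ?absz_gt0 //.
  by rewrite [LHS]hz -{1}(gtz0_abs zpos) -pmulrn.
have {}zneg : z < 0 by rewrite lt_neqAle z0.
exists (- w), `|z|%N; split; rewrite ?absz_gt0 //.
  rewrite [LHS]hz mulNrn -[RHS]opprK opprK pmulrn ltz0_abs //.
  by rewrite -mulrNz opprK.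
by move=> x /div[z' ->]; exists (- z'); rewrite mulrNz mulNrz opprK.
Qed.

(** * Moments and summation by parts *)

Lemma fsum_shift b (F : 'rV[int]_d -> rat) :
  \sum_(u \in [set: 'rV[int]_d]) F (u - b) = \sum_(u \in [set: 'rV[int]_d]) F u.
Proof.
symmetry; apply: (reindex_fsbigT (fun u => u - b)).
by exists (fun u => u + b) => u; rewrite ?subrK ?addrK.
Qed.

Lemma fsum_sub (F G : 'rV[int]_d -> rat) :
  finite_set [set u | F u != 0] -> finite_set [set u | G u != 0] ->
  \sum_(u \in [set: 'rV[int]_d]) (F u - G u) =
  \sum_(u \in [set: 'rV[int]_d]) F u - \sum_(u \in [set: 'rV[int]_d]) G u.
Proof.
move=> hF hG; pose A := [set u | F u != 0] `|` [set u | G u != 0].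
have hA : finite_set A by rewrite finite_setU.
have hw (H : 'rV[int]_d -> rat) : (forall u, ~ A u -> H u = 0) ->
    \sum_(u \in [set: 'rV[int]_d]) H u = \sum_(u \in A) H u.
  by move=> h; symmetry; apply: fsbig_widen => // u [_ /= /h].
have F0 u : ~ A u -> F u = 0 by move=> /not_orP[/negP]; rewrite negbK => /eqP.
have G0 u : ~ A u -> G u = 0 by move=> /not_orP[_ /negP]; rewrite negbK => /eqP.
rewrite (hw F) // (hw G) // hw => [|u hu]; last by rewrite F0 // G0 // subrr.
by rewrite !fsbig_finite // -sumrB.
Qed.

Definition line_finite w f :=
  forall v, finite_set [set u | par w (u - v) /\ f u != 0].

(* The moments of f along the line through v with direction w. *)
Definition moment c f w v p : rat :=
  \sum_(u \in [set: 'rV[int]_d]) (if par w (u - v) then f u * p.[(dotz c u)%:~R] else 0).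

Definition pshift (a : int) p : {poly rat} := p \Po ('X + (a%:~R)%:P).

Lemma horner_pshift a p (z : rat) : (pshift a p).[z] = p.[z + a%:~R].
Proof. by rewrite horner_comp hornerD hornerX hornerC. Qed.

Lemma moment_support w f v (F : 'rV[int]_d -> rat) : line_finite w f ->
  finite_set [set u | (if par w (u - v) then f u * F u else 0) != 0].
Proof.
move=> /(_ v); apply: sub_finite_set => u /=; case: ifP; rewrite ?eqxx // => _ h.
by split=> //; apply: contraNneq h => ->; rewrite mul0r.
Qed.

Lemma moment_sub c f w v p p' : line_finite w f ->
  moment c f w v (p - p') = moment c f w v p - moment c f w v p'.
Proof.
move=> hf; rewrite /moment -fsum_sub; try exact: moment_support.
apply: eq_fsbigr => u _; case: ifP; rewrite ?subrr // => _.
by rewrite hornerD hornerN mulrBr.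
Qed.

Lemma line_finite_shift w f b : line_finite w f -> line_finite w (fun u => f (u - b)).
Proof.
move=> hf v; apply: sub_finite_set (finite_image (fun u => u + b) (hf (v - b))).
move=> u [hu fu]; exists (u - b); last by rewrite subrK.
by split=> //; rewrite opprB addrA subrK.
Qed.

Lemma moment_diff c f w b v p : line_finite w f ->
  moment c (diff b f) w v p =
  moment c f w v p - moment c f w (v - b) (pshift (dotz c b) p).
Proof.
move=> hf; rewrite /moment -[X in _ - X](fsum_shift b) -fsum_sub; first last.
- have := @moment_support w _ v (fun u => p.[(dotz c u)%:~R]) (line_finite_shift b hf).
  apply: sub_finite_set => u /=; rewrite opprB addrA subrK.
  by case: ifP => // _; rewrite horner_pshift dotzB rmorphB /= subrK.
- exact: moment_support.
apply: eq_fsbigr => u _; rewrite opprB addrA subrK /diff.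
case: ifP; rewrite ?subrr // => _.
by rewrite horner_pshift dotzB rmorphB /= subrK mulrBl.
Qed.

Lemma moment_par c f w v v' p : par w (v - v') -> moment c f w v p = moment c f w v' p.
Proof.
move=> h; apply: eq_fsbigr => u _; congr (if _ then _ else _).
have -> : u - v' = (u - v) + (v - v') by rewrite addrA subrK.
apply/idP/idP => h'; first exact: parD.
by have := parB h' h; rewrite addrK.
Qed.

Definition pdelta (a : int) p : {poly rat} := p - pshift a p.

(** Translation by b maps the line to itself, so the difference operator passes from f to p. *)
Lemma moment_diff_par c f w b v p : line_finite w f -> par w b ->
  moment c (diff b f) w v p = moment c f w v (pdelta (dotz c b) p).
Proof.
move=> hf hb; rewrite moment_diff // moment_sub //; congr (_ - _).
by apply: moment_par; rewrite addrAC subrr add0r parN.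
Qed.

(** * The difference operator on polynomials *)

Lemma size_pshift a p : size (pshift a p) = size p.
Proof. by apply: size_comp_poly2; rewrite size_XaddC. Qed.

Lemma coef_XaddC_exp (z : rat) (n k : nat) : (n < k)%N -> (('X + z%:P) ^+ n)`_k = 0.
Proof. by move=> h; apply: nth_default; rewrite -[z]opprK polyCN size_exp_XsubC. Qed.

Lemma coef_XaddC_expn (z : rat) (n : nat) : (('X + z%:P) ^+ n)`_n = 1.
Proof.
elim: n => [|n IH]; first by rewrite coef1.
by rewrite exprS mulrDl coefD coefXM coefCM /= IH coef_XaddC_exp // mulr0 addr0.
Qed.

Lemma coef_XaddC_expnS (z : rat) (n : nat) : (('X + z%:P) ^+ n.+1)`_n = z * n.+1%:R.
Proof.
elim: n => [|n IH]; first by rewrite expr1 coefD coefX coefC add0r mulr1.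
rewrite exprS mulrDl coefD coefXM coefCM /= IH coef_XaddC_expn.
by rewrite mulr1 -[in RHS]natr1 mulrDr mulr1.
Qed.

Lemma pshift_sum a (n : nat) p : (size p <= n)%N ->
  pshift a p = \sum_(j < n) p`_j *: ('X + (a%:~R)%:P) ^+ j.
Proof.
move=> hp; have {1}-> : p = \sum_(j < n) p`_j *: 'X^j.
  rewrite -poly_def; apply/polyP => k; rewrite coef_poly.
  by case: ltnP => // h; apply: nth_default; apply: leq_trans h.
by rewrite /pshift raddf_sum; apply: eq_bigr => j _ /=; rewrite comp_polyZ comp_Xn_poly.
Qed.

(** The coefficients in degree n + 1 cancel, and the linear term in a of (X + a)^(n+1) gives the
    coefficient in degree n. *)
Lemma pdelta_step a (n : nat) p : (size p <= n.+2)%N ->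
  (size (pdelta a p) <= n.+1)%N /\ (pdelta a p)`_n = - (a%:~R * n.+1%:R * p`_n.+1).
Proof.
move=> hp; rewrite /pdelta (pshift_sum a hp) !big_ord_recr /=; split.
  apply/leq_sizeP => k hk; rewrite coefB !coefD !coefZ coef_sum big1 => [|j _].
    move: hk; rewrite leq_eqVlt => /orP[/eqP<-|hk].
      by rewrite coef_XaddC_exp // coef_XaddC_expn mulr0 mulr1 !add0r subrr.
    rewrite !coef_XaddC_exp ?(ltnW hk) // !mulr0 !addr0.
    by apply: nth_default; apply: leq_trans hp hk.
  by rewrite coefZ coef_XaddC_exp ?mulr0 // (leq_trans _ hk) // ltnS ltnW.
rewrite coefB !coefD !coefZ coef_sum big1 => [|j _]; last first.
  by rewrite coefZ coef_XaddC_exp ?mulr0.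
by rewrite coef_XaddC_expn coef_XaddC_expnS; ring.
Qed.

Lemma size_pdelta a (n : nat) p : (size p <= n.+1)%N -> (size (pdelta a p) <= n)%N.
Proof.
case: n => [|n] hp; last by case: (pdelta_step a hp).
rewrite (size1_polyC hp) /pdelta /pshift comp_polyC subrr size_poly0 //.
Qed.

Lemma pdeltaD a p p' : pdelta a (p + p') = pdelta a p + pdelta a p'.
Proof. by rewrite /pdelta /pshift comp_polyD opprD addrACA. Qed.

Lemma pdelta_surj a (n : nat) p : a != 0 -> (size p <= n)%N ->
  exists p', (size p' <= n.+1)%N /\ pdelta a p' = p.
Proof.
move=> a0; elim: n p => [|n IH] p hp.
  exists 0; rewrite size_poly0 /pdelta /pshift comp_poly0 subrr; split=> //.
  by apply/esym/eqP; rewrite -size_poly_leq0.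
(* The scalar is dictated by [pdelta_step]: the difference of q has the same coefficient in degree n
   as p. *)
pose q := (- p`_n / (a%:~R * n.+1%:R)) *: 'X^(n.+1) : {poly rat}.
have hq : (size q <= n.+2)%N by rewrite (leq_trans (size_scale_leq _ _)) ?size_polyXn.
have [h1 h2] := pdelta_step a hq.
have e : (pdelta a q)`_n = p`_n.
  have a1 : a%:~R != 0 :> rat by rewrite intr_eq0.
  have n1 : n.+1%:R != 0 :> rat by rewrite pnatr_eq0.
  rewrite h2 coefZ coefXn eqxx mulr1; move: (p`_n) (n.+1%:R : rat) n1 => y N n1.
  by rewrite mulrC divfK ?opprK // mulf_neq0.
have hp' : (size (p - pdelta a q)%R <= n)%N.
  apply/leq_sizeP => k; rewrite leq_eqVlt => /orP[/eqP<-|hk].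
    by rewrite coefB e subrr.
  by rewrite coefB !nth_default ?subrr // (leq_trans _ hk).
have [p1 [hp1 e1]] := IH _ hp'.
exists (p1 + q); split; last by rewrite pdeltaD e1 subrK.
by rewrite (leq_trans (size_polyD _ _)) // geq_max hq andbT ltnW.
Qed.

End Moments.

(** * Bounded supports *)

Section Boundedness.

Variable d : nat.
Implicit Types (u v w b c x : 'rV[int]_d) (bs : seq 'rV[int]_d).
Implicit Types (f h N H : laurent d) (p : {poly rat}).

(** True for generating series of subsets of N^d and stable under differences. Moving backwards
    along a lexicographically positive b leaves the support, as b has a positive entry. *)
Definition below f := exists L : int, forall u, f u != 0 -> forall l, L <= u 0 l.

Definition upto c f := exists M : int, forall u, f u != 0 -> dotz c u <= M.

Definition vanishing_moments c N w (k : nat) :=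
  forall v p, (size p <= k)%N -> moment c N w v p = 0.

Lemma below_combo s f : below f -> below (combo s f).
Proof.
move=> [L hL]; exists (L - \sum_(x <- s) \sum_l `|x.2 0%R l|) => u hu l.
have [x hx fx] : exists2 x, x \in s & f (u - x.2) != 0.
  apply: contrapT => no; move/eqP: hu; apply; rewrite /combo big1_seq // => x /= hx.
  have [->|fx] := eqVneq (f (u - x.2)) 0; first by rewrite mulr0.
  by case: no; exists x.
have := hL _ fx l; rewrite !mxE.
have : `|x.2 0 l| <= \sum_(x <- s) \sum_l `|x.2 0 l|.
  apply: (@le_trans _ _ (\sum_l `|x.2 0 l|)).
    by rewrite (bigD1 l) //= lerDl sumr_ge0.
  rewrite (big_rem x) //= lerDl sumr_ge0 // => y _.
  exact: sumr_ge0.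
have := ler_norm (- x.2 0 l); rewrite normrN.
move: (x.2 0 l) (u 0 l) (\sum_(_ <- _) _) => X U Z h1 h2 h3.
by rewrite lerBlDr (le_trans h3) // lerD2l (le_trans h1).
Qed.

Lemma below_diff b f : below f -> below (diff b f).
Proof. by move=> h; rewrite diff_combo; apply: below_combo. Qed.

Lemma below_diffs bs f : below f -> below (diffs bs f).
Proof. by move=> h; elim: bs => //= b bs; apply: below_diff. Qed.

Lemma upto_diff c b f : upto c f -> upto c (diff b f).
Proof.
move=> [M hM]; exists (M + `|dotz c b|) => u /diff_neq0[/hM|/hM]; rewrite ?dotzB; lia.
Qed.

Lemma upto_diffs c bs f : upto c f -> upto c (diffs bs f).
Proof. by move=> h; elim: bs => //= b bs; apply: upto_diff. Qed.

Lemma upto_finite c f : finite_set [set u | f u != 0] -> upto c f.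
Proof.
move=> /finite_seqP[s hs]; exists (\sum_(u <- s) `|dotz c u|) => u hu.
have us : u \in s by have : [set` s] u by rewrite -hs.
rewrite (big_rem u) //= (le_trans (ler_norm _)) // lerDl.
exact: sumr_ge0.
Qed.

Lemma below_vanish f b l u : below f -> 0 < b 0 l ->
  exists n, f (u - b *+ n) = 0.
Proof.
move=> [L hL] bl; exists (`|u 0%R l - L|%N.+1).
apply/eqP; apply: contraT => /hL /(_ l); rewrite !mxE mulmxnE -mulr_natr natz.
move: (b 0 l) (u 0 l) bl => B U B0 h; exfalso; nia.
Qed.

(** Points of the line are v + n w with w primitive: a positive entry of w bounds n from below, and
    c bounds it from above. *)
Lemma line_range b v (A B : int) : lex_positive b ->
  forall c, 0 < dotz c b ->
  finite_set [set u | [/\ par b (u - v), forall l, A <= u 0 l & dotz c u <= B]].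
Proof.
move=> hb c cb; have [b0 _] := hb; have [l bl] := lex_positive_coord hb.
have [w [g [g0 bw hprim]]] := par_primitive b0.
have wl : 0 < w 0 l by move: bl; rewrite bw mulmxnE pmulrn_lgt0.
have cw : 0 < dotz c w by move: cb; rewrite bw dotzMn pmulrn_lgt0.
pose K := (`|A - v 0%R l| + `|B - dotz c v|)%N.
apply: sub_finite_set (finite_image (fun k : nat => v + w *~ (k%:Z - K%:Z)) (finite_II (K + K).+1)).
move=> u [/hprim[n hn] hA hB].
have hu : u = v + w *~ n by rewrite -hn addrC subrK.
have h1 : A <= v 0 l + w 0 l * n.
  have := hA l; rewrite hu !mxE; case: (n) => z; rewrite ?NegzE ?mulrNz -?pmulrn ?mxE ?mulmxnE;
  by rewrite -mulr_natr natz ?mulrN.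
have h2 : dotz c v + dotz c w * n <= B.
  have := hB; rewrite hu dotzD; case: (n) => z; rewrite ?NegzE ?mulrNz -?pmulrn ?dotzN ?dotzMn;
  by rewrite -mulr_natr natz ?mulrN.
exists (absz (n + K%:Z)); last first.
  rewrite hu; congr (_ + _ *~ _); rewrite gez0_abs ?addrK //.
  by rewrite /K; nia.
by rewrite /= /K; nia.
Qed.

Lemma line_finite_bounded c f b : lex_positive b -> 0 < dotz c b ->
  below f -> upto c f -> line_finite b f.
Proof.
move=> hb cb [L hL] [M hM] v.
apply: sub_finite_set (@line_range b v L M hb c cb) => u [hp hf].
by split=> //; [exact: hL|exact: hM].
Qed.

(** Factors not parallel to b are absorbed into h. Each parallel one, summed by parts, lowers the
    degree of p, so that k of them kill degree < k. *)
Lemma moments_of_bounded c bs h b : lex_positive b -> 0 < dotz c b ->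
  below h -> upto c h ->
  vanishing_moments c (diffs bs h) b (count (par b) bs).
Proof.
move=> hb cb lo up v p; rewrite -size_filter (diffs_filter (par b)).
have {lo}lo := below_diffs (filter (predC (par b)) bs) lo.
have {up}up := upto_diffs (filter (predC (par b)) bs) up.
move: (diffs _ h) lo up => {}h lo up.
have : all (par b) (filter (par b) bs) by rewrite filter_all.
elim: (filter _ _) p => [|b' bs' IH] p /=.
  rewrite size_poly_leq0 => _ /eqP->; apply: fsbig1 => u _.
  by case: ifP => // _; rewrite horner0 mulr0.
move=> /andP[hb' hbs'] hp; rewrite moment_diff_par //.
  by apply: IH => //; apply: size_pdelta.
by apply: line_finite_bounded hb cb _ _; [exact: below_diffs|exact: upto_diffs].
Qed.

(** Stepping back by b does not decrease c, so beyond the bound M the value stays the same at every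
    step, until the support is left. *)
Lemma upto_nonpositive c bs h : below h ->
  (forall b, b \in bs -> lex_positive b /\ dotz c b <= 0) ->
  upto c (diffs bs h) -> upto c h.
Proof.
move=> lo; elim: bs => // b bs IH hbs; have [hb cb] := hbs b (mem_head _ _).
have [l bl] := lex_positive_coord hb.
move=> [M hM]; apply: IH; first by move=> b' hb'; apply: hbs; rewrite inE hb' orbT.
have {lo}lo := below_diffs bs lo.
exists M => u; apply: contraTT; rewrite -ltNge => hu.
suff shift n : diffs bs h u = diffs bs h (u - b *+ n).
  have [n hn] := below_vanish u lo bl.
  by rewrite (shift n) hn eqxx.
elim: n => [|n ->]; first by rewrite mulr0n subr0.
have h0 : diff b (diffs bs h) (u - b *+ n) = 0.
  apply/eqP; apply: contraTT hu => /hM; rewrite -leNgt dotzB dotzMn; apply: le_trans.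
  by rewrite lerDl oppr_ge0 mulrn_wle0.
move/eqP: h0; rewrite /diff subr_eq0 => /eqP->.
by rewrite -addrA -opprD -mulrSr.
Qed.

Lemma moment1_diff c f w v b : line_finite w f -> par w b ->
  moment c (diff b f) w v 1 = 0.
Proof.
move=> hf hb; rewrite moment_diff_par // /pdelta /pshift comp_polyC subrr.
by apply: fsbig1 => u _; case: ifP => // _; rewrite horner0 mulr0.
Qed.

Lemma finite_line_finite f w : finite_set [set u | f u != 0] -> line_finite w f.
Proof. by move=> h v; apply: sub_finite_set h => u []. Qed.

(* Truncating H at c u <= K, where K bounds c on the support of D_w H, leaves a
   finite Laurent polynomial; since the sum of D_w H on every line vanishes, so
   does H beyond K, so that H equals its truncation. *)
Lemma finite_antidifference c w H : lex_positive w -> 0 < dotz c w ->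
  (forall x, par w x -> exists n : int, x = w *~ n) ->
  below H -> finite_set [set u | diff w H u != 0] ->
  (forall v, moment c (diff w H) w v 1 = 0) ->
  finite_set [set u | H u != 0].
Proof.
move=> hw cw prim lo fin hmom; have [l wl] := lex_positive_coord hw.
set N := diff w H in fin hmom.
have [K hK] := upto_finite c fin.
have [K' hK'] := upto_finite (- c) fin.
have dotNl x : dotz (- c) x = - dotz c x.
  by rewrite /dotz -sumrN; apply: eq_bigr => l' _; rewrite mxE mulNr.
have HN u : N u = 0 -> H u = H (u - w).
  by move=> /eqP; rewrite subr_eq0 => /eqP.
pose T : laurent d := fun u => if dotz c u <= K then H u else 0.
(* Going back from a point of the support of H must meet the finite support of N; the bound on c
   limits the number of steps. *)
have finT : finite_set [set u | T u != 0].
  have fin2 := finite_image2 (fun (s : 'rV[int]_d) (n : nat) => s + w *+ n) fin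
    (finite_II (absz (K + K')).+1).
  apply: sub_finite_set fin2 => u /=; rewrite /T; case: ifP => [cu Hu|]; rewrite ?eqxx //.
  have [n hn] : exists n : nat, N (u - w *+ n) != 0.
    apply: contrapT => /forallNP no; move/eqP: Hu; apply.
    have [n <-] := below_vanish u lo wl.
    elim: n => [|n ->]; first by rewrite mulr0n subr0.
    rewrite HN; last by apply/eqP/negPn/negP/no.
    by rewrite -addrA -opprD -mulrSr.
  exists (u - w *+ n) => //; exists n; last by rewrite subrK.
  by have := hK' _ hn; rewrite /= dotNl dotzB dotzMn -mulr_natr; nia.
have diffT x : N x - diff w T x = if K < dotz c x <= K + dotz c w then H (x - w) else 0.
  rewrite /diff /T dotzB; have [cx|cx] /= := lerP (dotz c x) K.
    by rewrite /= ifT ?subrr // ; lia.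
  have -> : N x = 0 by apply/eqP; apply: contraLR cx => /hK; rewrite -leNgt.
  by rewrite lerBlDr sub0r opprB subr0.
(* On the line through u, the series N and D_w T differ only at u + w, by H u, because a window of
   length c w contains one point of the line. Both have zero sum there. *)
have window u : K - dotz c w < dotz c u <= K -> H u = 0.
  move=> cu; have h0 : moment c N w u 1 - moment c (diff w T) w u 1 = 0.
    by rewrite hmom moment1_diff ?subrr ?par_refl //; apply: finite_line_finite.
  move: h0; rewrite /moment -fsum_sub; first last.
  - apply: moment_support; apply: finite_line_finite.
    apply: sub_finite_set (_ : finite_set ([set u | T u != 0] `|` [set u | T (u - w) != 0])).
      by move=> x /diff_neq0[h|h]; [left|right].
    rewrite finite_setU; split=> //.
    apply: sub_finite_set (finite_image (fun u => u + w) finT) => x /= hx.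
    by exists (x - w); rewrite ?subrK.
  - by apply: moment_support; apply: finite_line_finite.
  rewrite (eq_fsbigr (fun x => (x == u + w)%:R * H (x - w))); last first.
    move=> x _; rewrite !hornerC !mulr1; case: ifP => [hp|hp].
      rewrite diffT; have [n hn] := prim _ hp.
      have hx : x = u + w *~ n by rewrite -hn addrC subrK.
      have cx : dotz c x = dotz c u + dotz c w * n.
        rewrite hx dotzD; congr (_ + _); case: (n) => z;
        by rewrite ?NegzE ?mulrNz -?pmulrn ?dotzN ?dotzMn -mulr_natr natz ?mulrN.
      have [n1|n1] := eqVneq n 1.
        rewrite hx n1 mulr1z eqxx mul1r ifT //.
        by rewrite dotzD; lia.
      rewrite ifF.
        case: eqP => [e|_]; last by rewrite mul0r.
        move/eqP: n1; case; move: cx; rewrite e dotzD => /addrI.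
        by rewrite -{1}[dotz c w]mulr1 => /(mulfI (lt0r_neq0 cw)).
      rewrite cx; apply/negP => h; move/eqP: n1; apply; nia.
    case: eqP => [e|_]; last by rewrite mul0r subrr.
    by move: hp; rewrite e addrAC subrr add0r par_refl.
  by rewrite fsum_single addrK.
(* Beyond K, H is invariant under steps back by w, so its value is one taken in the window, which is
   0. *)
have HT u : H u != 0 -> T u = H u.
  rewrite /T; case: ifP => // /negbT; rewrite -ltNge => cu; case/negP.
  have shift n : K < dotz c u - dotz c w *+ n + dotz c w -> H u = H (u - w *+ n).
    elim: n => [|n IH] hn; first by rewrite mulr0n subr0.
    have {}hn : K < dotz c u - dotz c w *+ n.
      by move: hn; rewrite mulrS opprD addrA addrAC [_ - dotz c w + _]addrAC addrK.
    rewrite IH; last by apply: lt_trans hn _; rewrite ltrDl.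
    rewrite HN; first by rewrite -addrA -opprD -mulrSr.
    apply/eqP; apply: contraLR hn => /hK; rewrite dotzB dotzMn.
    by rewrite -leNgt.
  have /ex_minnP[n hn hmin] : exists n, dotz c u - dotz c w *+ n <= K.
    by exists `|dotz c u - K|%N; rewrite -mulr_natr; nia.
  have hn' : K < dotz c u - dotz c w *+ n + dotz c w.
    case: n hn hmin => [|n] hn hmin; first by rewrite mulr0n subr0 in hn; rewrite leNgt cu in hn.
    rewrite ltNge; apply/negP => h; suff : (n.+1 <= n)%N by rewrite ltnn.
    apply: hmin; move: h.
    by rewrite mulrS opprD addrA addrAC [_ - dotz c w + _]addrAC addrK.
  rewrite (shift n hn') window ?eqxx //.
  by rewrite dotzB dotzMn hn andbT ltrBlDr.
by apply: sub_finite_set finT => u /= Hu; rewrite HT.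
Qed.

End Boundedness.

(** * The moment criterion *)

Section MomentCriterion.

Variable d : nat.
Implicit Types (u v w b c x : 'rV[int]_d) (bs ps ns : seq 'rV[int]_d).
Implicit Types (f h N H : laurent d) (p : {poly rat}).

(** Every p of degree < k is the difference of a polynomial of degree at most k, as c w is
    nonzero. *)
Lemma vanishing_moments_par c H w b k :
  finite_set [set u | H u != 0] -> par b w -> dotz c w != 0 ->
  vanishing_moments c (diff w H) b k.+1 -> vanishing_moments c H b k.
Proof.
move=> fin hw cw hm v p /(pdelta_surj cw)[p' [hp' <-]].
rewrite -moment_diff_par //; first exact: hm.
exact: finite_line_finite.
Qed.

(** Two translates of the line meeting the same point would make a multiple of w parallel to b, so
    each point of s is met at most once. *)
Lemma lines_escape (s : seq 'rV[int]_d) w b v : ~~ par b w ->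
  exists n : nat, forall u, u \in s -> ~~ par b (u - (v - w *+ n)).
Proof.
move=> hbw.
suff [n0 hn0] : exists n0, forall n, (n0 <= n)%N -> forall u, u \in s ->
    ~~ par b (u - (v - w *+ n)).
  by exists n0; apply: hn0.
elim: s => [|u0 s [n0 hn0]]; first by exists 0%N.
have [n1 hn1] : exists n1, forall n, (n1 <= n)%N -> ~~ par b (u0 - (v - w *+ n)).
  case: (pselect (exists n1, par b (u0 - (v - w *+ n1)))) => [[n1 h1]|no].
    exists n1.+1 => n hn; apply: contra hbw => h2.
    have := parB h2 h1; have -> : u0 - (v - w *+ n) - (u0 - (v - w *+ n1)) = w *+ (n - n1).
      rewrite mulrnBr ?(ltnW hn) //; move: (w *+ n) (w *+ n1) => a a1.
      by apply/rowP => l; rewrite !mxE; ring.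
    by apply: par_Mn; rewrite subn_gt0.
  by exists 0%N => n _; apply/negP => h; apply: no; exists n.
exists (maxn n0 n1) => n; rewrite geq_max => /andP[h0 h1] u.
by rewrite inE => /orP[/eqP->|]; [exact: hn1|exact: hn0].
Qed.

(** The moment equals one along the line translated by -w, with p replaced by a shift of the same
    degree; after enough translations the line misses the support. *)
Lemma vanishing_moments_nonpar c H w b k :
  finite_set [set u | H u != 0] -> ~~ par b w ->
  vanishing_moments c (diff w H) b k -> vanishing_moments c H b k.
Proof.
move=> fin hbw hm v p hp.
have step n : exists p', (size p' <= k)%N /\ moment c H b v p = moment c H b (v - w *+ n) p'.
  elim: n => [|n [p' [hp' ->]]]; first by exists p; rewrite mulr0n subr0.
  exists (pshift (dotz c w) p'); rewrite size_pshift; split=> //.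
  have := moment_diff c w (v - w *+ n) p' (finite_line_finite b fin).
  rewrite hm // => /esym/eqP; rewrite subr_eq0 => /eqP->.
  by rewrite -addrA -opprD -mulrSr.
have /finite_seqP[s hs] := fin.
have [n hn] := lines_escape s v hbw.
have [p' [_ ->]] := step n; apply: fsbig1 => u _; case: ifP => // hu.
suff -> : H u = 0 by rewrite mul0r.
apply/eqP; apply: contraT => Hu.
have us : u \in s by have : [set` s] u by rewrite -hs.
by have := hn u us; rewrite hu.
Qed.

Lemma diff_multiple w g f :
  diff w (combo [seq (1, w *+ i) | i <- iota 0 g] f) = diff (w *+ g) f.
Proof.
apply/funext => u; rewrite /diff /combo !big_map.
elim: g => [|g IH]; first by rewrite !big_nil mulr0n [u - 0]subr0 !subrr.
have -> : iota 0 g.+1 = iota 0 g ++ [:: g] by rewrite -addn1 iotaD.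
rewrite !big_cat !big_seq1 /= !mul1r.
rewrite opprD addrACA IH mulrSr opprD addrA.
have -> : u - w - w *+ g = u - w *+ g - w by rewrite addrAC.
by rewrite addrA subrK.
Qed.

Lemma lex_positive_divisor w g : lex_positive (w *+ g) -> lex_positive w.
Proof.
have [->|g0] := posnP g; first by rewrite mulr0n => -[]; rewrite eqxx.
move=> [h0 h]; split; first by apply: contraNneq h0 => ->; rewrite mul0rn.
move=> l wl hl; have := h l; rewrite mulmxnE pmulrn_lgt0 //; apply.
  by rewrite mulrn_eq0 negb_or -lt0n g0.
by move=> l' /hl wl'; rewrite mulmxnE wl' mul0rn.
Qed.

(** Induction on the factors with c b > 0. Replacing h by h' = (1 + x^w + ... + x^((g-1)w)) h turns
    1 - x^b into 1 - x^w, which can be divided out of the Laurent polynomial; since 0 <= h <= h', a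
    bound for h' suffices. *)
Lemma bounded_of_moments c ps ns h : below h -> (forall u, 0 <= h u) ->
  (forall b, b \in ps -> lex_positive b /\ 0 < dotz c b) ->
  (forall b, b \in ns -> lex_positive b /\ dotz c b <= 0) ->
  finite_set [set u | diffs (ps ++ ns) h u != 0] ->
  (forall b, b \in ps -> vanishing_moments c (diffs (ps ++ ns) h) b (count (par b) ps)) ->
  upto c h.
Proof.
move=> lo h0 hps hns; elim: ps h lo h0 hps => [|b ps IH] h lo h0 hps fin hm.
  by apply: (upto_nonpositive lo hns); apply: upto_finite.
have [hb cb] := hps b (mem_head _ _); have [b0 _] := hb.
have [w [g [g0 bw prim]]] := par_primitive b0.
have hw : lex_positive w by apply: (@lex_positive_divisor _ g); rewrite -bw.
have cw : 0 < dotz c w by move: cb; rewrite bw dotzMn pmulrn_lgt0.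
have parwb : par w b by rewrite bw parMn ?par_refl.
have parE x : par w x = par b x.
  apply/idP/idP; last exact: par_trans.
  by apply: par_trans; [case: hw|rewrite par_sym].
pose h' := combo [seq (1, w *+ i) | i <- iota 0 g] h.
have lo' : below h' by apply: below_combo.
have hh' u : h u <= h' u.
  rewrite /h' /combo big_map; case: (g) g0 => // g' _ /=.
  rewrite big_cons /= mulr0n subr0 mul1r lerDl sumr_ge0 // => i _.
  by rewrite mul1r.
have h0' u : 0 <= h' u by apply: le_trans (hh' u).
have diffH : diff w (diffs (ps ++ ns) h') = diffs ((b :: ps) ++ ns) h.
  by rewrite -diffs_diff /h' diff_multiple -bw diffs_diff.
have finH : finite_set [set u | diffs (ps ++ ns) h' u != 0].
  apply: (finite_antidifference hw cw) => //.
  - by move=> x; rewrite parE; apply: prim.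
  - exact: below_diffs.
  - by rewrite diffH.
  - move=> v; rewrite diffH; have := hm b (mem_head _ _) v 1.
    rewrite size_poly1 /= par_refl => /(_ isT) e.
    by rewrite -[RHS]e; apply: eq_fsbigr => u _; rewrite parE.
have [M hM] : upto c h'.
  apply: IH => // [b' hb'|b' hb']; first by apply: hps; rewrite inE hb' orbT.
  have := hm b'; rewrite inE hb' orbT => /(_ isT); rewrite -diffH /=.
  have [hb0 _] : lex_positive b' /\ 0 < dotz c b' by apply: hps; rewrite inE hb' orbT.
  case: hb0 => b'0 _.
  (* Dividing out 1 - x^w costs one degree for directions parallel to b, matching the lost factor,
     and none for the others. *)
  have [hbb'|hbb'] := boolP (par b' b).
    rewrite add1n; apply: vanishing_moments_par => //; last by rewrite gt_eqF.
    by apply: par_trans hbb' _ => //; rewrite par_sym.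
  rewrite add0n; apply: vanishing_moments_nonpar => //.
  by apply: contra hbb' => hw'; apply: par_trans hw' _ => //; case: hw.
exists M => u hu; apply: hM; apply: contra_neq hu => hu.
by apply/eqP; rewrite eq_le h0 andbT -hu hh'.
Qed.

Lemma bounded_iff_moments c bs h : below h -> (forall u, 0 <= h u) ->
  (forall b, b \in bs -> lex_positive b) ->
  finite_set [set u | diffs bs h u != 0] ->
  upto c h <-> forall b, b \in bs -> 0 < dotz c b ->
    vanishing_moments c (diffs bs h) b (count (par b) bs).
Proof.
move=> lo h0 hbs fin; split=> [up b /hbs hb cb|hm].
  exact: moments_of_bounded.
pose pos b := 0 < dotz c b.
have e : diffs bs h = diffs (filter pos bs ++ filter (predC pos) bs) h.
  by rewrite diffs_cat -diffs_filter.
apply: (@bounded_of_moments c (filter pos bs) (filter (predC pos) bs)) => //.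
- by move=> b; rewrite mem_filter => /andP[? /hbs].
- by move=> b; rewrite mem_filter /= -leNgt => /andP[? /hbs].
- by rewrite -e.
move=> b; rewrite mem_filter -e => /andP[cb hb] v p hp.
apply: (hm b hb cb); apply: leq_trans hp _.
by rewrite count_filter; apply: sub_count => x /andP[].
Qed.

Lemma finite_combo (s : seq (rat * 'rV[int]_d)) :
  finite_set [set u | combo s (monomial 0) u != 0].
Proof.
apply: sub_finite_set (finite_seq [seq y.2 | y <- s]) => u /= hu; apply: contraT => us; move/eqP: hu; case.
rewrite /combo big1_seq // => x /= hx; rewrite /monomial subr_eq0.
case: eqP => [e|_]; last by rewrite mulr0.
by case/negP: us; rewrite e map_f.
Qed.

Lemma moment_combo c (I : finType) (alpha : I -> rat) (q : I -> 'rV[int]_d) w v p :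
  moment c (combo [seq (alpha j, q j) | j <- enum I] (monomial 0)) w v p =
  \sum_j if par w (q j - v) then alpha j * p.[(dotz c (q j))%:~R] else 0.
Proof.
rewrite /moment.
rewrite (eq_fsbigr (fun u => combo [seq (alpha j, q j) | j <- enum I] (monomial 0) u *
    (if par w (u - v) then p.[(dotz c u)%:~R] else 0))); last first.
  by move=> u _; case: ifP; rewrite ?mulr0.
rewrite fsum_combo big_map big_enum; apply: eq_bigr => j _ /=.
by case: ifP; rewrite ?mulr0.
Qed.

(** Only lines through some q_j and powers of c need testing. The fixed bound K keeps the quantifier
    over r finite and independent of t, although k will depend on t. *)
Lemma vanishing_moments_combo c (I : finType) (alpha : I -> rat)
    (q : I -> 'rV[int]_d) w (k K : nat) : (k <= K)%N ->
  vanishing_moments c (combo [seq (alpha j, q j) | j <- enum I] (monomial 0)) w k <->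
  forall (j0 : I) (r : 'I_K), (r < k)%N ->
    \sum_j (if par w (q j - q j0) then alpha j * (dotz c (q j))%:~R ^+ r else 0) = 0.
Proof.
move=> kK; split=> [h j0 r rk|h v p hp].
  have := h (q j0) 'X^r; rewrite size_polyXn => /(_ rk); rewrite moment_combo => e; rewrite -[RHS]e.
  by apply: eq_bigr => j _; rewrite hornerXn.
rewrite moment_combo; case: (pselect (exists j0, par w (q j0 - v))) => [[j0 hj0]|no]; last first.
  by apply: big1 => j _; case: ifP => // hj; case: no; exists j.
have e j : par w (q j - v) = par w (q j - q j0).
  apply/idP/idP => hj.
    by have := parB hj hj0; rewrite opprB addrA subrK.
  by have := parD hj hj0; rewrite addrA subrK.
transitivity (\sum_(r < size p) p`_r *
    \sum_j (if par w (q j - q j0) then alpha j * (dotz c (q j))%:~R ^+ r else 0)).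
  under [RHS]eq_bigr do rewrite mulr_sumr.
  rewrite exchange_big; apply: eq_bigr => j _; rewrite e.
  case: ifP => _; last by rewrite big1 // => r _; rewrite mulr0.
  by rewrite horner_coef mulr_sumr; apply: eq_bigr => r _; rewrite mulrCA.
apply: big1 => r _; have rk : (r < k)%N by apply: leq_trans hp.
by rewrite (h j0 (Ordinal (leq_trans rk kK))) ?mulr0.
Qed.

End MomentCriterion.

(** * Deciding boundedness along a residue class *)

Section BoundednessGerm.

Variables (m i d : nat).

Lemma dec_par (w x : nat -> 'rV[int]_d) : germ_vec m i w -> germ_vec m i x ->
  germ_dec m i (fun t => par (w t) (x t)).
Proof.
move=> hw hx.
have h k l : germ_dec m i (fun t => (w t 0 k)%:~R * (x t 0 l)%:~R = (w t 0 l)%:~R * (x t 0 k)%:~R :> rat).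
  by apply: dec_eq; apply: poly_mul.
apply: dec_ext (dec_forall (fun k => dec_forall (h k))) => t.
split=> [e|/parP e k l]; last by rewrite -!rmorphM e.
by apply/parP => k l; apply/eqP; rewrite -(eqr_int rat) !rmorphM e.
Qed.

Lemma poly_count (J : Type) (js : seq J) (a : J -> nat -> bool) :
  (forall j, germ_dec m i (a j)) ->
  germ_poly m i (fun t => (count (fun j => a j t) js)%:R).
Proof.
move=> ha.
apply: poly_ext (poly_sum js (fun j => poly_if (ha j) (poly_cst m i 1) (poly_cst m i 0))) => t.
elim: js => [|j js IH] /=; first by rewrite big_nil.
by rewrite big_cons natrD IH; case: (a j t).
Qed.

Lemma dec_upto (c : 'rV[int]_d) (f : nat -> laurent d) :
  (forall t, below (f t)) -> (forall t u, 0 <= f t u) -> rational_germ m i f ->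
  germ_dec m i (fun t => upto c (f t)).
Proof.
move=> lo f0 [k [b [hb hpos [I [alpha [q [hq hN]]]]]]].
pose cnt l t := count (fun j => par (b l t) (b j t)) (enum 'I_k).
apply: (@dec_near _ _ (fun t => forall l : 'I_k, 0 < dotz c (b l t) ->
  forall (j0 : I) (r : 'I_k), (r < cnt l t)%N ->
   \sum_j (if par (b l t) (q j t - q j0 t) then alpha j * (dotz c (q j t))%:~R ^+ r else 0) = 0)).
  apply: near_mono2 hpos hN => t hp e.
  rewrite (bounded_iff_moments c (lo t) (f0 t) (bs := [seq b j t | j <- enum 'I_k])); last first.
  - by rewrite e; apply: finite_combo.
  - by move=> v /mapP[j _ ->].
  rewrite e.
  have ck l : (cnt l t <= k)%N.
    by rewrite /cnt; apply: leq_trans (count_size _ _) _; rewrite size_enum_ord.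
  have cE l : count (par (b l t)) [seq b j t | j <- enum 'I_k] = cnt l t.
    by rewrite count_map.
  split=> [h v /mapP[l _ ->] cv|h l cl].
    by rewrite cE; apply/(vanishing_moments_combo c alpha (fun j => q j t) _ (ck l)); apply: h.
  apply/(vanishing_moments_combo c alpha (fun j => q j t) _ (ck l)); rewrite -cE.
  by apply: h => //; rewrite map_f ?mem_enum.
apply: dec_forall => l; apply: dec_imp.
  apply: dec_ext (dec_gt0 (poly_dotz (vec_cst m i c) (hb l))) => t.
  by rewrite ltr0z.
apply: dec_forall => j0; apply: dec_forall => r; apply: dec_imp.
  apply: dec_ext (dec_lt (poly_cst m i r%:R) (poly_count (enum 'I_k) (fun j => dec_par (hb l) (hb j)))) => t.
  by rewrite ltr_nat.
apply: dec_eq0; apply: poly_sum => j; apply: poly_if.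
- by apply: dec_par => //; apply: vec_sub.
- apply: poly_mul; first exact: poly_cst.
  by apply: poly_exp; apply: poly_dotz => //; apply: vec_cst.
exact: poly_cst.
Qed.

End BoundednessGerm.

(** * Counting *)

Section Counting.

Variable d : nat.
Implicit Types (u b c : 'rV[int]_d) (bs : seq 'rV[int]_d) (h : laurent d).

(* The direction 0 makes [moment c h 0 0] a sum over the whole lattice; each
   difference operator lowers the degree of p, so that p of degree [size bs]
   only leaves the total mass of h. *)
Lemma moment_diffs_total c bs h (p : {poly rat}) :
  finite_set [set u | h u != 0] -> (size p <= (size bs).+1)%N ->
  moment c (diffs bs h) 0 0 p =
  p`_(size bs) * (size bs)`!%:R * \prod_(b <- bs) - (dotz c b)%:~R * moment c h 0 0 1.
Proof.
move=> fin; have fins cs : finite_set [set u | diffs cs h u != 0].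
  elim: cs => //= b cs IH.
  apply: (@sub_finite_set _ _
    ([set u | diffs cs h u != 0] `|` [set u | diffs cs h (u - b) != 0])).
    by move=> u /diff_neq0[]; [left|right].
  rewrite finite_setU; split=> //.
  apply: sub_finite_set (finite_image (fun u => u + b) IH) => u /= hu.
  by exists (u - b); rewrite ?subrK.
elim: bs p => [|b bs IH] p hp /=.
  rewrite big_nil fact0 !mulr1 /moment mulr_fsumr; apply: eq_fsbigr => u _.
  rewrite {1}(size1_polyC hp) !hornerC mulr1 mulrC; case: ifP => //; rewrite mulr0 //.
rewrite moment_diff_par; first last.
- by apply/parP => k l; rewrite !mxE !mul0r.
- exact: finite_line_finite.
have [h1 h2] := pdelta_step (dotz c b) hp.
rewrite IH // h2 big_cons factS natrM; ring.
Qed.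

End Counting.

(** * Cardinality along a residue class *)

Section CountingGerm.

Variables (m i d : nat).

Lemma generic_functional (k : nat) (b : 'I_k -> nat -> 'rV[int]_d) : (0 < m)%N ->
  (forall j, germ_vec m i (b j)) -> near_class m i (fun t => forall j, b j t != 0) ->
  exists c, near_class m i (fun t => forall j, dotz c (b j t) != 0).
Proof.
move=> m_gt0 hb b0; have /choice[B hB] (j : 'I_k) : exists B : 'I_d -> {poly rat},
    near_class m i (fun t => forall l, (b j t 0 l)%:~R = (B l).[t%:R]).
  by have /choice[B hB] := hb j; exists B; apply: near_forall.
have hB' := near_forall hB.
(* It suffices that c is nonzero on all b_j(t0) for a single t0: then the polynomials c b_j are
   nonzero, hence eventually nonvanishing. *)
have [t0 [_ _ [ht0 ht0']]] := near_witness m_gt0 (near_and b0 hB') 0.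
pose P j : {poly rat} := \sum_(l < d) (b j t0 0 l)%:~R *: 'X^l.
have P0 : \prod_j P j != 0.
  apply/prodf_neq0 => j _; have [l [hl _]] := first_nonzero (ht0 j).
  apply/eqP => /polyP /(_ l); rewrite coef0 /P coef_sum (bigD1 l) //= big1.
    rewrite coefZ coefXn eqxx mulr1 addr0 => /eqP.
    by rewrite intr_eq0 (negbTE hl).
  move=> l' ll'; rewrite coefZ coefXn; case: eqP => [e|_]; last by rewrite mulr0.
  by move: ll'; rewrite -(inj_eq val_inj) /= e eqxx.
(* For c = (1, a, a^2, ...), c b_j(t0) is P_j(a), so any natural number a that is not a root of the
   product works. *)
have [a [_ _ ha]] := near_witness m_gt0 (poly_nonzero_near m i P0) 0.
pose c : 'rV[int]_d := \row_l a%:Z ^+ l; exists c.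
have E j t : (forall l, (b j t 0 l)%:~R = (B j l).[t%:R]) ->
    (dotz c (b j t))%:~R = (\sum_l (c 0 l)%:~R *: B j l).[t%:R].
  move=> e; rewrite rmorph_sum horner_sum; apply: eq_bigr => l _.
  by rewrite rmorphM /= e hornerZ.
apply: near_forall => j.
have Q0 : \sum_l (c 0 l)%:~R *: B j l != 0.
  apply: contraTneq ha => e; apply/negPn.
  have := E j t0 (ht0' j); rewrite e horner0 => /eqP.
  rewrite horner_prod intr_eq0 => /eqP c0; apply/prodf_eq0; exists j => //.
  rewrite /P horner_sum /=.
  transitivity ((dotz c (b j t0))%:~R == 0 :> rat); last by rewrite c0.
  congr (_ == _); rewrite rmorph_sum; apply: eq_bigr => l _.
  by rewrite hornerZ hornerXn mxE rmorphM rmorphXn mulrC.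
apply: near_mono2 (poly_nonzero_near m i Q0) (hB j) => t hQ e.
by rewrite -(intr_eq0 rat) E.
Qed.

Lemma card_generating_series (A : set 'rV[nat]_d) c v : finite_set A ->
  moment c (generating_series A) 0 v 1 = #|` fset_set A|%fset%:R.
Proof.
move=> fin; rewrite /moment.
rewrite -(@fsbig_widen _ _ _ _ (map_mx Posz @` A)) //; last first.
  move=> u [_ /= hu]; suff -> : generating_series A u = 0 by rewrite mul0r if_same.
  apply/eqP; apply: contraT => /generating_series_neq0[s hs e].
  by case: hu; exists s.
rewrite fsbig_image; last by move=> s s' _ _; apply: map_Posz_inj.
rewrite fsbig_finite // (eq_big_seq (fun=> 1)).
  by rewrite big_const_seq count_predT iter_addr_0.
move=> s; rewrite in_fset_set // => /set_mem hs.
rewrite generating_series_in // hornerC mulr1 ifT //.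
by apply/parP => k l; rewrite !mxE !mul0r.
Qed.

(** The moment of X^k is computed twice: from the explicit exponents it is [A], and by summation by
    parts it is |S_t| times [B]. *)
Lemma card_germ (S : nat -> set 'rV[nat]_d) : (0 < m)%N ->
  rational_germ m i (fun t => generating_series (S t)) ->
  near_class m i (fun t => finite_set (S t)) ->
  germ_poly m i (fun t => #|` fset_set (S t)|%fset%:R).
Proof.
move=> m_gt0 [k [b [hb hpos [I [alpha [q [hq hN]]]]]]] fin.
have [c hc] : exists c, near_class m i (fun t => forall j, dotz c (b j t) != 0).
  by apply: generic_functional => //; apply: near_mono hpos => t h j; case: (h j).
pose A t := \sum_j alpha j * (dotz c (q j t))%:~R ^+ k.
pose B t := k`!%:R * \prod_(j <- enum 'I_k) - (dotz c (b j t))%:~R : rat.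
have hcq q' : germ_vec m i q' -> germ_poly m i (fun t => (dotz c (q' t))%:~R).
  by apply: poly_dotz; apply: vec_cst.
apply: poly_ext (@poly_integral_quotient m i
  (fun t => #|` fset_set (S t)|%fset%:Z) A B _ _ _ _) => //.
- apply: poly_sum => j; apply: poly_mul; first exact: poly_cst.
  by apply: poly_exp; apply: hcq.
- apply: poly_mul; first exact: poly_cst.
  by apply: poly_prod => j; apply: poly_opp; apply: hcq.
- apply: near_mono hc => t h; rewrite mulf_neq0 //.
    by rewrite pnatr_eq0 -lt0n fact_gt0.
  by rewrite big_enum; apply/prodf_neq0 => j _; rewrite oppr_eq0 intr_eq0.
apply: near_mono2 hN fin => t e hfin.
have fs : finite_set [set u | generating_series (S t) u != 0].
  apply: sub_finite_set (finite_image (map_mx Posz) hfin) => u.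
  by move=> /generating_series_neq0[s hs ->]; exists s.
have := @moment_diffs_total d c [seq b j t | j <- enum 'I_k] _ 'X^k fs.
rewrite size_map size_enum_ord size_polyXn => /(_ (leqnn _)).
rewrite e coefXn eqxx mul1r big_map card_generating_series // -/(B t) mulrC => <-.
rewrite moment_combo; apply: eq_bigr => j _.
rewrite hornerXn ifT //.
by apply/parP => l l'; rewrite !mxE !mul0r.
Qed.

End CountingGerm.

(** * The properties *)

Section Properties.

Variable d : nat.
Implicit Types (S : nat -> set 'rV[nat]_d) (A : set 'rV[nat]_d) (c : 'rV[int]_d).

(** The negated coordinates break ties; they separate points and are bounded above on N^d, so only c
    can prevent a largest exponent. *)
Definition forms c : seq 'rV[int]_d := c :: [seq - delta_mx 0 l | l <- enum 'I_d].

Lemma dotz_delta l (u : 'rV[int]_d) : dotz (delta_mx 0 l) u = u 0 l.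
Proof.
rewrite /dotz (bigD1 l) //= mxE !eqxx mul1r big1 ?addr0 // => k kl.
by rewrite mxE (negbTE kl) andbF mul0r.
Qed.

Lemma dotzNl c u : dotz (- c) u = - dotz c u.
Proof. by rewrite /dotz -sumrN; apply: eq_bigr => l _; rewrite mxE mulNr. Qed.

Lemma dotz_map_Posz c (s : 'rV[nat]_d) : dotz c (map_mx Posz s) = dot c s.
Proof. by apply: eq_bigr => l _; rewrite mxE. Qed.

Lemma separating_forms c : separating (forms c).
Proof.
move=> u h; apply/rowP => l; rewrite mxE; apply/eqP; rewrite -oppr_eq0.
rewrite -dotz_delta -dotzNl h // inE; apply/orP; right.
by apply/mapP; exists l; rewrite ?mem_enum.
Qed.

Lemma below_generating_series A : below (generating_series A).
Proof. by exists 0 => u /generating_series_neq0[s _ ->] l; rewrite mxE. Qed.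

Lemma upto_generating_series c A :
  upto c (generating_series A) <-> exists M, forall s, A s -> dot c s <= M.
Proof.
split=> -[M hM]; exists M.
  by move=> s hs; rewrite -dotz_map_Posz hM // generating_series_in ?oner_eq0.
by move=> u /generating_series_neq0[s hs ->]; rewrite dotz_map_Posz hM.
Qed.

Lemma lead_generating_series c A : A !=set0 -> upto c (generating_series A) ->
  exists s, lead (forms c) (generating_series A) s.
Proof.
move=> [s0 hs0] hc; apply: lead_exists; first exact: separating_forms.
  by exists (map_mx Posz s0); rewrite generating_series_in ?oner_eq0.
move=> c'; rewrite inE => /orP[/eqP->//|/mapP[l _ ->]].
exists 0 => u /generating_series_neq0[s _ ->].
by rewrite dotzNl dotz_delta mxE oppr_le0.
Qed.

Lemma upto0 (f : laurent d) : upto 0 f.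
Proof. by exists 0 => u _; rewrite /dotz big1 // => l _; rewrite mxE mul0r. Qed.

Lemma nonempty_generating_series A :
  A !=set0 <-> exists u, generating_series A u != 0.
Proof.
split=> [[s hs]|[u /generating_series_neq0[s hs _]]]; last by exists s.
by exists (map_mx Posz s); rewrite generating_series_in ?oner_eq0.
Qed.

Lemma lead_maximizes c A s : lead (forms c) (generating_series A) s ->
  exists2 y, s = map_mx Posz y & maximizes c A y.
Proof.
move=> [/generating_series_neq0[y hy ->] h]; exists y => //; split=> // z hz.
have [->//|zy] := eqVneq z y.
have := h (map_mx Posz z); rewrite generating_series_in ?oner_eq0 // => /(_ isT).
rewrite (inj_eq (@map_Posz_inj d)) => /(_ zy) /orP[|/andP[/eqP h0 _]].
  by rewrite dotzB subr_gt0 !dotz_map_Posz => /ltW.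
by move/eqP: h0; rewrite dotzB subr_eq0 !dotz_map_Posz => /eqP->.
Qed.

Lemma finite_upto A :
  finite_set A <-> forall l : 'I_d, upto (delta_mx 0 l) (generating_series A).
Proof.
split=> [fin l|h].
  apply: upto_finite; apply: sub_finite_set (finite_image (map_mx Posz) fin) => u.
  by move=> /generating_series_neq0[s hs ->]; exists s.
have /choice[M hM] (l : 'I_d) : exists M : nat, forall s, A s -> (s 0%R l <= M)%N.
  have /upto_generating_series[M hM] := h l; exists `|M|%N => s /hM.
  rewrite -dotz_map_Posz dotz_delta mxE => hs.
  by rewrite -lez_nat (le_trans hs) // abszE ler_norm.
pose B := \max_l M l.
apply: (@sub_finite_set _ _ (range (fun f : {ffun 'I_d -> 'I_B.+1} => \row_l (f l : nat)))).
  move=> s hs; have hb l : (s 0%R l < B.+1)%N.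
    by rewrite ltnS (leq_trans (hM l s hs)) //; apply: leq_bigmax.
  exists [ffun l => Ordinal (hb l)] => //.
  by apply/rowP => l; rewrite mxE ffunE.
by apply: finite_image; apply: finite_finset.
Qed.

(** * Maximizers, nonemptiness and finiteness along a residue class *)

Section ClassProperties.

Variables (m i : nat).

Definition germ_nvec (y : nat -> 'rV[nat]_d) :=
  forall l, germ_poly m i (fun t => (y t 0 l)%:R).

(** A candidate maximizer may have negative entries where no maximum exists. Absolute values bring
    it into N^d and stay polynomial, as signs are eventually constant. *)
Lemma nvec_absz (x : nat -> 'rV[int]_d) : germ_vec m i x ->
  germ_nvec (fun t => map_mx absz (x t)).
Proof.
move=> hx l.
have hdec : germ_dec m i (fun t => 0 <= x t 0 l).
  by apply: dec_ext (dec_le (poly_cst m i 0) (hx l)) => t; rewrite ler0z.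
apply: poly_ext (poly_if hdec (hx l) (poly_opp (hx l))) => t.
rewrite mxE pmulrn abszE; case: ifP => [h|/negbT]; first by rewrite ger0_norm.
by rewrite -ltNge => h; rewrite ltr0_norm // rmorphN.
Qed.

Lemma nvec_Posz (y : nat -> 'rV[nat]_d) : germ_nvec y ->
  germ_vec m i (fun t => map_mx Posz (y t)).
Proof. by move=> hy l; apply: poly_ext (hy l) => t; rewrite mxE. Qed.

Variable S : nat -> set 'rV[nat]_d.
Hypothesis ratS : rational_germ m i (fun t => generating_series (S t)).

Lemma max_germ c : exists y, germ_nvec y /\
  near_class m i (fun t => (exists z, maximizes c (S t) z) -> maximizes c (S t) (y t)).
Proof.
have [x [hx near_x]] := rational_lead (@separating_forms c) ratS.
exists (fun t => map_mx absz (x t)); split; first exact: nvec_absz.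
apply: near_mono near_x => t ht [z [hz hmax]].
have [||s hs] := @lead_generating_series c (S t).
- by exists z.
- by apply/upto_generating_series; exists (dot c z).
have [y sy hy] := lead_maximizes hs.
rewrite -(ht s hs) sy; have -> : map_mx absz (map_mx Posz y) = y.
  by apply/rowP => l; rewrite !mxE.
exact: hy.
Qed.

Lemma dec_nonempty : germ_dec m i (fun t => S t !=set0).
Proof.
apply: dec_ext (rational_nonzero (@separating_forms 0) ratS _) => [t|].
  by rewrite nonempty_generating_series.
apply: near_all => t /nonempty_generating_series h.
by apply: lead_generating_series h (upto0 _).
Qed.

Lemma dec_bounded c : germ_dec m i (fun t => upto c (generating_series (S t))).
Proof.
apply: dec_upto => // t; first exact: below_generating_series.
exact: generating_series_ge0.
Qed.

Lemma dec_max c : germ_dec m i (fun t => exists z, maximizes c (S t) z).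
Proof.
apply: dec_ext (dec_and dec_nonempty (dec_bounded c)) => t; split.
  move=> [S0 hc]; have [s hs] := lead_generating_series S0 hc.
  by have [y _ hy] := lead_maximizes hs; exists y.
move=> [z [hz hmax]]; split; first by exists z.
by apply/upto_generating_series; exists (dot c z).
Qed.

Lemma dec_finite : germ_dec m i (fun t => finite_set (S t)).
Proof.
apply: dec_ext (dec_forall (fun l => dec_bounded (delta_mx 0 l))) => t.
by rewrite finite_upto.
Qed.

End ClassProperties.

(** * Extracting k distinct points *)

Lemma card_ge_setD1 (k : nat) A s : A s ->
  (`I_k.+1 #<= A)%card <-> (`I_k #<= A `\ s)%card.
Proof.
move=> hs; rewrite !card_ge_IIP; split=> [[x [x_inj hx]]|[x [x_inj hx]]].
  case: (pselect (exists j, x j = s)) => [[j hj]|no].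
    exists (fun i => x (lift j i)); split=> [i i' /x_inj /lift_inj //|i].
    split=> //= e; have := neq_lift j i.
    by rewrite -(inj_eq x_inj) hj e eqxx.
  exists (fun i => x (lift ord0 i)); split=> [i i' /x_inj /lift_inj //|i].
  by split=> //= e; apply: no; exists (lift ord0 i).
exists (fun i => if unlift ord0 i is Some i' then x i' else s); split=> [i i'|i].
  case: unliftP => [j ->|->]; case: unliftP => [j' ->|->] //.
  - by move=> /x_inj e; rewrite e.
  - by move=> e; case: (hx j) => _ [].
  - by move=> e; case: (hx j') => _ []; rewrite /= -e.
by case: unliftP => [j _|_] //; have [] := hx j.
Qed.

(** Induction on k for all families at once: along the class S_t is eventually empty, or a point
    y(t) can be removed and the result applied to the rest. *)
Lemma distinct_germ (m i k : nat) S : (0 < m)%N ->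
  rational_germ m i (fun t => generating_series (S t)) ->
  germ_dec m i (fun t => `I_k #<= S t)%card /\
  exists x : 'I_k -> nat -> 'rV[nat]_d,
    (forall j, germ_nvec m i (x j)) /\
    near_class m i (fun t => (`I_k #<= S t)%card ->
      injective (fun j => x j t) /\ forall j, S t (x j t)).
Proof.
move=> m0; elim: k S => [|k IH] S ratS.
  split; last first.
    exists (fun=> fun=> 0); split=> [[]//|].
    by apply: near_all => t _; split; case.
  by left; apply: near_all => t; apply/card_ge_IIP; exists (fun=> 0); split; case.
case: (dec_nonempty ratS) => [ne|em]; last first.
  have em' : near_class m i (fun t => ~ (`I_k.+1 #<= S t)%card).
    apply: near_mono em => t h /card_ge_IIP[x [_ hx]]; apply: h.
    by exists (x ord0).
  split; first by right.
  exists (fun=> fun=> 0); split=> [j l|].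
    by apply: poly_ext (poly_cst m i 0) => t; rewrite mxE.
  by apply: near_mono em' => t.
have [y [hy near_y]] := max_germ ratS 0.
(* Every point maximizes the zero form, so y(t) is simply a point of S_t. *)
have {}near_y : near_class m i (fun t => S t (y t)).
  apply: near_mono2 ne near_y => t S0 /(_ _)[] //.
  have [s hs] := lead_generating_series S0 (upto0 _).
  by have [z _ hz] := lead_maximizes hs; exists z.
have ratS' : rational_germ m i (fun t => generating_series (S t `\ y t)).
  apply: rational_near (rational_sub_monomial (nvec_Posz hy) ratS).
  by apply: near_mono near_y => t h; rewrite generating_seriesD1.
have [hdec [x [hx near_x]]] := IH _ ratS'.
have near_k : near_class m i (fun t =>
    (`I_k.+1 #<= S t)%card <-> (`I_k #<= S t `\ y t)%card).
  by apply: near_mono near_y => t; apply: card_ge_setD1.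
split; first by apply: dec_near hdec; apply: near_mono near_k => t ->.
exists (fun j => if unlift ord0 j is Some j' then x j' else y); split=> [j|].
  by case: unliftP.
apply: near_mono2 (near_and near_k near_y) near_x => t [hk hy'] h /hk /h[x_inj x_in].
split=> [j j'|j].
  case: unliftP => [l ->|->]; case: unliftP => [l' ->|->] //.
  - by move=> /x_inj e; rewrite e.
  - by move=> e; case: (x_in l) => _ [].
  - by move=> e; case: (x_in l') => _ []; rewrite /= -e.
by case: unliftP => [l _|_] //; have [] := x_in l.
Qed.

(** * Consequences of Property 4, assembled from the residue classes *)

Lemma property4_property2 S : property4 S -> property2 S.
Proof.
move=> /property4_germ[m [m0 hS]]; split; last first.
  by apply: (periodic_of_dec m0) => i; apply: dec_finite.
have [t|i|g [hg qg]] := @glue_classes m nat unit (fun _ n => n%:R)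
  (fun t n => finite_set (S t) -> n = #|` fset_set (S t)|%fset) m0.
- by exists (#|` fset_set (S t)|%fset).
- case: (dec_finite (hS i)) => [fin|inf].
    exists (fun t => #|` fset_set (S t)|%fset); split; last by apply: near_all.
    by move=> _; apply: card_germ.
  (* Where S_t is eventually infinite nothing is required of g, and 0 serves. *)
  exists (fun=> 0%N); split=> [_|]; first exact: poly_cst.
  by apply: near_mono inf => t.
by exists g; split=> //; apply: qg tt.
Qed.

Lemma property4_property3a S : property4 S -> property3a S.
Proof.
move=> /property4_germ[m [m0 hS]] c _; split; last first.
  by apply: (periodic_of_dec m0) => i; apply: dec_max.
have [t|i|x [hx qx]] := @glue_classes m 'rV[nat]_d 'I_d (fun l y => (y 0 l)%:R)
  (fun t y => (exists z, maximizes c (S t) z) -> maximizes c (S t) y) m0.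
- case: (pselect (exists z, maximizes c (S t) z)) => [[z hz]|no]; last by exists 0.
  by exists z.
- exact: max_germ.
by exists x; split.
Qed.

Lemma property4_property3b S : property4 S -> property3b S.
Proof.
move=> /property4_germ[m [m0 hS]] k; split; last first.
  by apply: (periodic_of_dec m0) => i; case: (distinct_germ k m0 (hS i)).
have [t|i|x [hx qx]] := @glue_classes m ('I_k -> 'rV[nat]_d) ('I_k * 'I_d)
  (fun jl y => (y jl.1 0 jl.2)%:R)
  (fun t y => (`I_k #<= S t)%card -> injective y /\ forall j, S t (y j)) m0.
- case: (pselect (`I_k #<= S t)%card) => [/card_ge_IIP[y hy]|no].
    by exists y.
  by exists (fun=> 0).
- have [_ [x [hx near_x]]] := distinct_germ k m0 (hS i).
  by exists (fun t j => x j t); split=> // -[j l]; apply: hx.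
exists (fun j t => x t j); split=> // j l.
exact: (qx (j, l)).
Qed.

End Properties.

Theorem theorem3p3 (d : nat) (hd : (0 < d)%N)
    (S : nat -> set 'rV[nat]_d) :
  (property4 S -> property2 S) /\
  (property4 S -> property3a S) /\
  (property4 S -> property3b S) /\
  (property2 S -> property1 S) /\
  (property3a S -> property3 S) /\
  (property3b S -> property3 S) /\
  (property3 S -> property1 S).
Proof.
split; first exact: property4_property2.
split; first exact: property4_property3a.
split; first exact: property4_property3b.
split; first exact: property2_property1.
split; first exact: property3a_property3.
split; first exact: property3b_property3.
exact: property3_property1.
Qed.
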